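(* Let $K$ be a field of prime characteristic $p$, $S=K[x_1,\ldots,x_n]$ the standard graded polynomial ring, and $I\subsetneq S$ a graded ideal. Let $q$ always denote a power of $p$. Then the following hold. (1) $\alpha_q(I)\leq \mathrm{v}(I^{[q]})$ for each $q>1$. (2) $\left\{\frac{\alpha_q(I)}{q}\right\}$ is a non-decreasing sequence in $q$, where $q=p^e>1$. (3) The limit $\lim_{q\to\infty}\frac{\alpha_q(I)}{q}$ exists (as a finite real number). (4) If $I$ is a radical ideal, then there exists an associated prime $\mathfrak{p}\in\mathrm{Ass}(I)$ such that $\alpha_q(I)\geq \mathrm{v}(I^{[q]})-\mathrm{v}_{\mathfrak{p}}(I)$ for each $q>1$. (5) If $I$ is a radical ideal, then $\lim_{q\to\infty}\frac{\alpha_q(I)}{q}=\lim_{q\to\infty}\frac{\mathrm{v}(I^{[q]})}{q}$. (6) If $I$ is an unmixed square-free monomial ideal, then for any $q>\dim S$ we have $\left\lceil \frac{\alpha_q(I)}{q}\right\rceil=\mathrm{v}(I)+\mathrm{ht}(I)$, where $\lceil z\rceil$ denotes the least integer greater than or equal to $z$.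
   Context: The $q$-th Frobenius power of $I$ is $I^{[q]}=(a^q : a\in I)$, where $q=p^e$ with $e\ge 0$. For $q>1$, define $\alpha_q(I)=\min\left\{d \,\middle|\, \left[\frac{I^{[q]}:I}{I^{[q]}}\right]_d\neq 0\right\}$, where $[M]_d$ denotes the degree-$d$ component of a graded module $M$; that is, $\alpha_q(I)$ is the least degree of a homogeneous element of $(I^{[q]}:I)\setminus I^{[q]}$. $\mathrm{Ass}(I)$ denotes the set of associated primes of $S/I$. For a proper graded ideal $I$ and $\mathfrak{p}\in\mathrm{Ass}(I)$, $\mathrm{v}_{\mathfrak{p}}(I)=\min\{d\ge 0\mid \exists f\in S_d \text{ with } I:f=\mathfrak{p}\}$ and $\mathrm{v}(I)=\min\{\mathrm{v}_{\mathfrak{p}}(I)\mid\mathfrak{p}\in\mathrm{Ass}(I)\}$. The height $\mathrm{ht}(I)$ (respectively big height $\mathrm{bight}(I)$) is the minimum (respectively maximum) of the heights of the associated primes of $I$; $I$ is unmixed if $\mathrm{ht}(I)=\mathrm{bight}(I)$. A square-free monomial ideal is one whose minimal monomial generators are all square-free. Limits are taken along $q=p^e$, $e\to\infty$. *)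

(* Defs.v *)
From HB Require Import structures.
From mathcomp Require Import all_boot all_order all_algebra.
From mathcomp Require Import mpoly.
From mathcomp Require Import boolp classical_sets.

Set Implicit Arguments.
Unset Strict Implicit.
Unset Printing Implicit Defensive.

Local Open Scope classical_set_scope.
Local Open Scope ring_scope.

(* Both are total, with value 0 where no minimum (maximum) exists.  Every set *)
(* to which they are applied below does have one, by Noetherianity and        *)
(* finiteness of dimension of polynomial rings over a field.                  *)
Definition nat_min (A : set nat) : nat :=
  xget 0%N [set d | A d /\ forall e, A e -> (d <= e)%N].
Definition nat_max (A : set nat) : nat :=
  xget 0%N [set d | A d /\ forall e, A e -> (e <= d)%N].

Section Ideals.
Variable R : comNzRingType.
Implicit Types (A I J P : set R).

(* idealr_closed includes 1 \notin I, so this is "I is an ideal and I != R".  *)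
Definition is_proper_ideal I : Prop := idealr_closed (mem I).

Definition is_prime_ideal P : Prop :=
  is_proper_ideal P /\ prime_idealr_closed (mem P).

Definition ideal_gen A : set R :=
  [set f | exists s : seq (R * R),
     (forall t, t \in s -> A t.2) /\ f = \sum_(t <- s) t.1 * t.2].

Definition colon I J : set R := [set f | forall g, J g -> I (f * g)].

Definition frob_power (q : nat) I : set R :=
  ideal_gen [set a ^+ q | a in I].

Definition is_radical_ideal I : Prop :=
  forall (f : R) (k : nat), I (f ^+ k) -> I f.

Definition Ass I : set (set R) :=
  [set P | is_prime_ideal P /\ exists f : R, colon I [set f] = P].

(* c 0 `<` c 1 `<` ... `<` c k; the values c i with k < i are irrelevant.     *)
Definition prime_chain (c : nat -> set R) (k : nat) : Prop :=
  (forall i, (i <= k)%N -> is_prime_ideal (c i)) /\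
  (forall i, (i < k)%N -> c i `<` c i.+1).

Definition prime_height P : nat :=
  nat_max [set k | exists c, prime_chain c k /\ c k = P].

Definition ht I : nat := nat_min [set prime_height P | P in Ass I].
Definition bight I : nat := nat_max [set prime_height P | P in Ass I].
Definition unmixed I : Prop := ht I = bight I.

End Ideals.

Definition krull_dim (R : comNzRingType) : nat :=
  nat_max [set k | exists c : nat -> set R, prime_chain c k].

Section GradedIdeals.
Variables (K : fieldType) (n : nat).
Implicit Types (I P : set {mpoly K[n]}).

Definition graded I : Prop :=
  forall (f : {mpoly K[n]}) (d : nat), I f -> I (pihomog mdeg d f).

Definition alpha (q : nat) I : nat :=
  nat_min [set d | exists f : {mpoly K[n]},
    [/\ f \is d.-homog, colon (frob_power q I) I f & ~ frob_power q I f]].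

Definition v_local P I : nat :=
  nat_min [set d | exists f : {mpoly K[n]},
    f \is d.-homog /\ colon I [set f] = P].

Definition v_number I : nat := nat_min [set v_local P I | P in Ass I].

Definition is_monomial_ideal I : Prop :=
  exists M : set 'X_{1..n}, I = ideal_gen [set 'X_[K, m] | m in M].

Definition min_monomial_gen I (m : 'X_{1..n}) : Prop :=
  I 'X_[m] /\ forall m' : 'X_{1..n}, I 'X_[m'] -> (m' <= m)%MM -> m' = m.

Definition squarefree_monomial_ideal I : Prop :=
  is_monomial_ideal I /\
  forall m : 'X_{1..n}, min_monomial_gen I m -> forall i, (m i <= 1)%N.

End GradedIdeals.

(* Main.v *)
Require Import Defs.
From mathcomp Require Import all_boot all_order all_algebra.
From mathcomp Require Import mpoly.
From mathcomp Require Import boolp classical_sets reals topology normedtype.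
From mathcomp Require Import sequences.
From mathcomp Require Import zify ring.
Import numFieldNormedType.Exports.
Import Order.TTheory GRing.Theory Num.Theory.

(** The number [alpha q I] is compared with other invariants by means of
    Cartier maps: additive maps [phi] with [phi (a ^+ q * x) = a * phi x].
    Such a map sends [J^[q]] into [J], and conversely [f] is in [J^[q]] as soon
    as every [phi f] is in [J] ([exists_cartier_nmem]).  Over an arbitrary field
    [K] they come from a projection of [K] onto its subfield of [q]-th powers,
    linear over that subfield and followed by the [q]-th root
    ([exists_frobenius_splitting]), combined with the choice of a residue class
    of exponents modulo [q]; this makes them divide degrees by [q].

    Parts 1 to 5.  If [I^[q] : f] is prime then it contains [I], whence
    [alpha_le_v_number].  If [f] is optimal for [q * r], some [r]-Cartier map
    takes it to an element of [I^[q] : I], still outside [I^[q]], of degree at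
    most [alpha (q * r) I / r]; this is monotonicity ([alpha_mul]).
    Multiplying [1] greedily by generators of [I] bounds [alpha q I] linearly
    in [q] ([alpha_linear_bound]), so the limit exists.  If [I] is radical and
    [f] is optimal for [q], a Cartier map gives [phi f] outside [I], and [I^[q]
    : f] lies in an associated prime [P = I : g] of [I] with [g] outside [P];
    then [I^[q] : (f * g) = P] ([radical_v_number_le]).  A radical ideal has
    finitely many associated primes, so one [P] of largest local v-number
    serves all [q], and the limits of [alpha / q] and [v / q] coincide.

    Part 6.  The associated primes of [I] are generated by [ht I] variables.
    If [I : g] is generated by the variables in [A], the product of [g ^+ q]
    and of the [(q - 1)]-st powers of these variables bounds [alpha q I] by
    [q * (v + ht)].  Conversely an optimal monomial has exponent [q - 1] at
    every variable of every associated prime that avoids its [q]-th root, the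
    exponents being rounded down.  Multiplying that root by the variables that
    belong to some of these primes but not to a chosen one gives a witness for
    the chosen prime; the loss is at most [n], which is less than [q].

    Three pieces of theory support this: Hilbert's basis theorem
    ([mpoly_noetherian], through Dickson's lemma), which yields associated
    primes; the existence of homogeneous witnesses ([homogeneous_witness]); and
    the dimension theory of polynomial rings ([prime_chain_length]), which gives
    [krull_dim {mpoly K[n]} = n] and the heights of the variable ideals. *)

Set Implicit Arguments.
Unset Strict Implicit.
Unset Printing Implicit Defensive.

Local Open Scope classical_set_scope.
Local Open Scope ring_scope.

(** * Ideals, Noetherian rings and associated primes *)

Section Ideals.
Variable R : comNzRingType.
Implicit Types (A I J P : set R) (f g h u v : R).

Definition is_ideal J : Prop :=
  J 0 /\ forall a u v, J u -> J v -> J (a * u + v).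

Lemma is_proper_idealE J : is_proper_ideal J <-> is_ideal J /\ ~ J 1.
Proof.
split=> [[J0 J1 JD]|[[J0 JD] J1]].
  split; last by move/mem_set; apply/negP.
  by split=> [|a u v /mem_set Ju /mem_set Jv]; apply: set_mem => //; exact: JD.
split; first exact: mem_set.
  by apply/negP => /set_mem.
by move=> a u v /set_mem Ju /set_mem Jv; apply/mem_set/JD.
Qed.

Lemma is_prime_idealE P : is_prime_ideal P <->
  [/\ is_ideal P, ~ P 1 & forall u v, P (u * v) -> P u \/ P v].
Proof.
split=> [[/is_proper_idealE [idP P1] prP]|[idP P1 prP]].
  by split=> // u v /mem_set /prP /orP[] /set_mem; [left|right].
split; first exact/is_proper_idealE.
by move=> u v /set_mem /prP [] /mem_set ->; rewrite ?orbT.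
Qed.

Section IdealTheory.
Variables (J : set R) (idJ : is_ideal J).

Lemma ideal_zero : J 0. Proof. by case: idJ. Qed.

Lemma ideal_mull a u : J u -> J (a * u).
Proof. by case: idJ => J0 JD Ju; rewrite -[_ * _]addr0; apply: JD. Qed.

Lemma ideal_mulr a u : J u -> J (u * a).
Proof. by rewrite mulrC; apply: ideal_mull. Qed.

Lemma ideal_add u v : J u -> J v -> J (u + v).
Proof. by case: idJ => J0 JD Ju; rewrite -[u]mul1r; apply: JD. Qed.

Lemma ideal_opp u : J u -> J (- u).
Proof. by rewrite -mulN1r; apply: ideal_mull. Qed.

Lemma ideal_sub u v : J u -> J v -> J (u - v).
Proof. by move=> Ju /ideal_opp; apply: ideal_add. Qed.

Lemma ideal_sum (T : eqType) (s : seq T) (Q : pred T) (F : T -> R) :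
  (forall t, t \in s -> Q t -> J (F t)) -> J (\sum_(t <- s | Q t) F t).
Proof.
move=> JF; rewrite big_seq_cond.
apply: big_ind => [||t /andP[]]; [exact: ideal_zero|exact: ideal_add|exact: JF].
Qed.

Lemma ideal_exp u k : (0 < k)%N -> J u -> J (u ^+ k).
Proof. by case: k => // k _ Ju; rewrite exprS; apply: ideal_mulr. Qed.

End IdealTheory.

Lemma ideal_gen_ideal A : is_ideal (ideal_gen A).
Proof.
split; first by exists [::]; rewrite big_nil.
move=> a _ _ [s [sA ->]] [s' [s'A ->]].
exists ([seq (a * t.1, t.2) | t <- s] ++ s'); split=> [t|].
  by rewrite mem_cat => /orP[/mapP[t' /sA At' ->]//|/s'A].
rewrite big_cat big_map mulr_sumr; congr (_ + _).
by apply: eq_bigr => t _; rewrite mulrA.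
Qed.

Lemma mem_ideal_gen A f : A f -> ideal_gen A f.
Proof.
move=> Af; exists [:: (1, f)]; rewrite big_seq1 mul1r; split=> // t.
by rewrite inE => /eqP->.
Qed.

Lemma ideal_gen_min A J : is_ideal J -> (A `<=` J) -> ideal_gen A `<=` J.
Proof.
move=> idJ AJ _ [s [sA ->]]; apply: ideal_sum => // t /sA /AJ Jt _.
exact: ideal_mull.
Qed.

Lemma ideal_genS A B : A `<=` B -> ideal_gen A `<=` ideal_gen B.
Proof.
move=> AB; apply: ideal_gen_min; first exact: ideal_gen_ideal.
by move=> f /AB /mem_ideal_gen.
Qed.

Lemma colon1E I f g : colon I [set f] g <-> I (g * f).
Proof. by split=> [|Igf _ ->//]; apply. Qed.

Lemma colon1_ideal I f : is_ideal I -> is_ideal (colon I [set f]).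
Proof.
move=> idI; split=> [|a u v /colon1E Iu /colon1E Iv]; apply/colon1E.
  by rewrite mul0r; apply: ideal_zero.
by rewrite mulrDl -mulrA; apply: ideal_add => //; apply: ideal_mull.
Qed.

Definition noetherian : Prop :=
  forall J, is_ideal J -> exists s : seq R, J = ideal_gen [set` s].

Lemma ideal_gen_range_finite (f : nat -> R) g : ideal_gen (range f) g ->
  exists N, ideal_gen [set f i | i in [set i | (i < N)%N]] g.
Proof.
have mono N M : (N <= M)%N ->
    ideal_gen [set f i | i in [set i | (i < N)%N]] `<=`
    ideal_gen [set f i | i in [set i | (i < M)%N]].
  move=> NM; apply: ideal_genS => _ [i /= iN <-]; exists i => //=.
  exact: leq_trans NM.
pose U : set R :=
  [set g | exists N, ideal_gen [set f i | i in [set i | (i < N)%N]] g].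
apply: (@ideal_gen_min _ U).
  split=> [|a u v [N Nu] [M Mv]].
    by exists 0%N; apply: ideal_zero (ideal_gen_ideal _).
  exists (maxn N M); apply: ideal_add (ideal_gen_ideal _) _ _ _ _.
    apply: ideal_mull (ideal_gen_ideal _) _ _ _.
    exact: (mono _ _ (leq_maxl N M) _ Nu).
  exact: (mono _ _ (leq_maxr N M) _ Mv).
by move=> _ [i _ <-]; exists i.+1; apply: mem_ideal_gen; exists i => /=.
Qed.

(** A form of the ascending chain condition: the generators of the ideal of
    all [f i] appear at a finite stage. *)
Lemma noetherian_seq (f : nat -> R) : noetherian ->
  exists N, ideal_gen [set f i | i in [set i | (i < N)%N]] (f N).
Proof.
move=> noeth; have [s Es] := noeth _ (ideal_gen_ideal (range f)).
suff [N sN] : exists N, forall x, x \in s ->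
    ideal_gen [set f i | i in [set i | (i < N)%N]] x.
  exists N; have : ideal_gen (range f) (f N).
    by apply: mem_ideal_gen; exists N.
  by rewrite Es; apply: ideal_gen_min (ideal_gen_ideal _) _ _.
have {Es} : forall x, x \in s -> ideal_gen (range f) x.
  by move=> x xs; rewrite Es; apply: mem_ideal_gen.
elim: s => [|x s IHs] sf; first by exists 0%N.
have [N sN] : exists N, forall y, y \in s ->
    ideal_gen [set f i | i in [set i | (i < N)%N]] y.
  by apply: IHs => y ys; apply: sf; rewrite inE ys orbT.
have [M xM] := ideal_gen_range_finite (sf x (mem_head _ _)).
exists (maxn N M) => y; rewrite inE => /orP[/eqP->|/sN yN].
  apply: ideal_genS _ xM => _ [i /= iM <-]; exists i => //=.
  by rewrite leq_max iM orbT.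
apply: ideal_genS _ yN => _ [i /= iN <-]; exists i => //=.
by rewrite leq_max iN.
Qed.

(** If no [colon I [set h * u]] were prime, each failure of primality
    [I (a * b * (h * u))] would allow passing from [u] to [u * a]; the
    witnesses [b] collected on the way would contradict [noetherian_seq]. *)
Lemma exists_prime_colon I h : noetherian -> is_ideal I -> ~ I h ->
  exists u, is_prime_ideal (colon I [set h * u]).
Proof.
move=> noeth idI Ih; apply: contrapT => noprime.
have step u : exists ab : R * R, ~ I (h * u) ->
    [/\ I (ab.1 * ab.2 * (h * u)), ~ I (ab.1 * (h * u)) & ~ I (ab.2 * (h * u))].
  apply: contrapT => noab; apply: noprime; exists u.
  have Ihu : ~ I (h * u) by move=> Ihu; apply: noab; exists (0, 0).
  apply/is_prime_idealE; split; first exact: colon1_ideal.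
    by move/colon1E; rewrite mul1r.
  move=> a b /colon1E Iab; apply: contrapT => /not_orP [na nb].
  apply: noab; exists (a, b) => _.
  by split=> // Iu; [apply: na|apply: nb]; apply/colon1E.
have [ab abP] := choice step.
pose u := fix u k := if k is k'.+1 then u k' * (ab (u k')).1 else 1.
have Iu k : ~ I (h * u k).
  elim: k => [|k IHk] /=; first by rewrite mulr1.
  have [_ + _] := abP _ IHk.
  by rewrite [X in ~ I X -> _]mulrCA [X in h * X]mulrC.
have [N] := noetherian_seq (fun k => (ab (u k)).2) noeth.
suff sub : ideal_gen [set (ab (u i)).2 | i in [set i | (i < N)%N]] `<=`
    colon I [set h * u N].
  by move/sub/colon1E; have [] := abP _ (Iu N).
apply: ideal_gen_min; first exact: colon1_ideal.
move=> _ [i /= iN <-]; apply/colon1E.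
have [Iab _ _] := abP _ (Iu i).
have [w ->] : exists w, u N = u i * (ab (u i)).1 * w.
  elim: N iN => // N IHN; rewrite ltnS leq_eqVlt => /orP[/eqP <-|/IHN[w Ew]].
    by exists 1; rewrite mulr1.
  by exists (w * (ab (u N)).1); rewrite /= {1}Ew mulrA.
rewrite [X in I X](_ : _ = (ab (u i)).1 * (ab (u i)).2 * (h * u i) * w).
  exact: ideal_mulr.
by rewrite !mulrA; congr (_ * w); rewrite mulrC !mulrA.
Qed.

Lemma radical_colon_nmem I g : is_ideal I -> is_radical_ideal I ->
  is_prime_ideal (colon I [set g]) -> ~ colon I [set g] g.
Proof.
move=> idI radI /is_prime_idealE[_ P1 _] /colon1E Igg; apply: P1; apply/colon1E.
by rewrite mul1r; apply: (radI g 2); rewrite expr2.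
Qed.

(** Over a radical ideal the associated primes are pairwise incomparable, so
    that a witness for one of them lies in all the others. *)
Lemma radical_colon_mem I g g' : is_ideal I -> is_radical_ideal I ->
  is_prime_ideal (colon I [set g]) -> is_prime_ideal (colon I [set g']) ->
  colon I [set g] <> colon I [set g'] -> colon I [set g'] g.
Proof.
move=> idI radI prP prP' neq.
have [_ _ prg] := (is_prime_idealE _).1 prP.
have [_ _ prg'] := (is_prime_idealE _).1 prP'.
have I_colon f : I `<=` colon I [set f].
  by move=> a Ia; apply/colon1E; apply: ideal_mulr.
have [sub|/existsNP[a /not_implyP[Pa P'a]]] :=
    pselect (colon I [set g] `<=` colon I [set g']); last first.
  by have /colon1E/I_colon/prg'[] := Pa.
have [sub'|/existsNP[b /not_implyP[P'b Pb]]] :=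
    pselect (colon I [set g'] `<=` colon I [set g]).
  by case: neq; apply/seteqP.
have /colon1E/I_colon/prg[//|/sub] := P'b.
by move/(radical_colon_nmem idI radI prP').
Qed.

(** Radical ideals have finitely many associated primes, stated here as the
    boundedness of every numerical function of them: along an infinite
    sequence of distinct primes the witnesses would never enter the ideal
    generated by the preceding ones. *)
Lemma radical_Ass_bounded I (w : set R -> nat) : noetherian -> is_ideal I ->
  is_radical_ideal I -> exists M, forall P, Ass I P -> (w P <= M)%N.
Proof.
move=> noeth idI radI; apply: contrapT => unbounded.
have step M : exists g, is_prime_ideal (colon I [set g]) /\
    (M < w (colon I [set g]))%N.
  apply: contrapT => nog; apply: unbounded; exists M => P [prP [g gP]].
  rewrite leqNgt; apply/negP => ltMw; apply: nog.
  by exists g; rewrite gP; split.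
have [g gP] := choice step.
pose M := fix M k := if k is k'.+1 then w (colon I [set g (M k')]) else 0%N.
have w_lt i j : (i < j)%N ->
    (w (colon I [set g (M i)]) < w (colon I [set g (M j)]))%N.
  elim: j => // j IHj; rewrite ltnS leq_eqVlt => /orP[/eqP->|/IHj ltij].
    by have [_] := gP (M j.+1).
  by apply: ltn_trans ltij _; have [_] := gP (M j.+1).
have [N] := noetherian_seq (fun k => g (M k)) noeth.
suff sub : ideal_gen [set g (M i) | i in [set i | (i < N)%N]] `<=`
    colon I [set g (M N)].
  by move/sub; apply: radical_colon_nmem => //; have [] := gP (M N).
apply: ideal_gen_min; first exact: colon1_ideal.
move=> _ [i /= iN <-].
apply: radical_colon_mem => //; try by have [] := gP (M _).
  by have [] := gP (M i).
  by have [] := gP (M N).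
by move=> E; have := w_lt _ _ iN; rewrite E ltnn.
Qed.

End Ideals.

(** * Hilbert's basis theorem *)

Lemma nondecreasing_subsequence (f : nat -> nat) : exists s : nat -> nat,
  (forall i j, (i < j)%N -> (s i < s j)%N) /\
  (forall i j, (i <= j)%N -> (f (s i) <= f (s j))%N).
Proof.
have step k : exists m, (k <= m)%N /\ forall m', (k <= m')%N -> (f m <= f m')%N.
  pose Q v := `[< exists m, (k <= m)%N /\ f m = v >].
  have exQ : exists v, Q v by exists (f k); apply/asboolP; exists k.
  have [v /asboolP[m [km <-]] minv] := ex_minnP exQ.
  by exists m; split=> // m' km'; apply: minv; apply/asboolP; exists m'.
have [c cP] := choice step.
pose s := fix s k := if k is k'.+1 then c (s k').+1 else c 0%N.
have sS i : (s i < s i.+1)%N by have [] := cP (s i).+1.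
have s_lt i j : (i < j)%N -> (s i < s j)%N.
  elim: j => // j IHj; rewrite ltnS leq_eqVlt => /orP[/eqP->//|/IHj ltij].
  exact: ltn_trans ltij (sS j).
exists s; split=> // i j; rewrite leq_eqVlt => /orP[/eqP->//|/s_lt ltij].
by case: i ltij => [|i] ltij /=; [have [_] := cP 0%N|have [_] := cP (s i).+1];
  apply=> //; apply: leq_trans (ltnW ltij); have [] := cP (s i).+1.
Qed.

(** Dickson's lemma, obtained by making the exponents of one variable after
    another nondecreasing along a subsequence. *)
Lemma dickson n (u : nat -> 'X_{1..n}) :
  exists i j, (i < j)%N /\ (u i <= u j)%MM.
Proof.
suff [s [s_lt s_le]] : exists s : nat -> nat,
    (forall i j, (i < j)%N -> (s i < s j)%N) /\
    (forall k, k \in enum 'I_n -> forall i j, (i <= j)%N ->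
       (u (s i) k <= u (s j) k)%N).
  exists (s 0%N), (s 1%N); split; first exact: s_lt.
  by apply/mnm_lepP => k; apply: s_le => //; rewrite mem_enum.
elim: (enum 'I_n) => [|k l [s [s_lt s_le]]]; first by exists id.
have [t [t_lt t_le]] := nondecreasing_subsequence (fun i => u (s i) k).
exists (s \o t); split=> [i j ij|k' ]; first exact/s_lt/t_lt.
rewrite inE => /orP[/eqP->|k'l] i j ij; first exact: t_le.
apply: s_le => //; move: ij; rewrite leq_eqVlt => /orP[/eqP->//|/t_lt].
exact: ltnW.
Qed.

(** Hilbert's basis theorem.  If [J] were not finitely generated, picking
    repeatedly an element of [J] with least leading monomial outside the ideal
    generated so far would, by Dickson's lemma, produce one whose leading term
    can be cancelled by an earlier one. *)
Lemma mpoly_noetherian (K : fieldType) n : noetherian {mpoly K[n]}.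
Proof.
move=> J idJ; apply: contrapT => /forallNP nfg.
have step (s : seq {mpoly K[n]}) : exists f, (forall x, x \in s -> J x) ->
    [/\ J f, ~ ideal_gen [set` s] f &
      forall g, J g -> ~ ideal_gen [set` s] g -> (mlead f <= mlead g)%O].
  have [sJ|nsJ] := pselect (forall x, x \in s -> J x); last by exists 0.
  have [g [Jg sg]] : exists g, J g /\ ~ ideal_gen [set` s] g.
    apply: contrapT => nog; apply: (nfg s); apply/seteqP; split.
      by move=> g Jg; apply: contrapT => sg; apply: nog; exists g.
    exact: ideal_gen_min.
  move: {2}(mlead g) (erefl (mlead g)) => m.
  elim/(@ltmwf n): m g Jg sg => m IHm g Jg sg Em.
  have [minm|] := pselect (forall h, J h -> ~ ideal_gen [set` s] h ->
      (mlead g <= mlead h)%O); first by exists g.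
  move/existsNP => [h /not_implyP[Jh /not_implyP[sh /negP]]].
  by rewrite -ltNge Em => lt_hm; apply: (IHm _ lt_hm h).
have [F FP] := choice step.
pose s := fix s k := if k is k'.+1 then rcons (s k') (F (s k')) else [::].
have sJ k x : x \in s k -> J x.
  elim: k x => [|k IHk] x; first by [].
  rewrite /= mem_rcons inE => /orP[/eqP->|/IHk//].
  by have [] := FP (s k) IHk.
have Fs i j : (i < j)%N -> F (s i) \in s j.
  elim: j => // j IHj; rewrite ltnS leq_eqVlt /= mem_rcons inE.
  by move=> /orP[/eqP->|/IHj->]; rewrite ?eqxx ?orbT.
have [i [j [ij le_ij]]] := dickson (fun k => mlead (F (s k))).
have [Ji si _] := FP _ (@sJ i); have [Jj sj minj] := FP _ (@sJ j).
move: (Fs i j ij) le_ij Ji si Jj sj minj.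
move: (F (s i)) (F (s j)) => f g fs le_fg Jf sf Jg sg ming.
have f0 : f != 0.
  apply/eqP => f0; apply: sf; rewrite f0.
  exact: ideal_zero (ideal_gen_ideal _).
pose c := g@_(mlead g) / f@_(mlead f).
pose t := (c *: 'X_[mlead g - mlead f]) * f.
have st : ideal_gen [set` s j] t.
  by apply: ideal_mull (ideal_gen_ideal _) _ _ _; apply: mem_ideal_gen.
have Jt : J t by apply: ideal_mull.
have sgt : ~ ideal_gen [set` s j] (g - t).
  move=> sgt; apply: sg; rewrite -[g](subrK t).
  by apply: ideal_add (ideal_gen_ideal _) _ _ _ _.
have gt0 : g - t != 0.
  apply/eqP => E; apply: sgt; rewrite E.
  exact: ideal_zero (ideal_gen_ideal _).
have Et : t@_(mlead g) = g@_(mlead g).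
  rewrite /t -scalerAl mcoeffZ ['X_[_] * f]mulrC.
  rewrite -[X in mcoeff X _](submK le_fg) mcoeffMX /c divfK //.
  by rewrite mcoeff_eq0 negbK mlead_supp.
have lt : (mlead t <= mlead g)%O.
  apply: le_trans (mleadM_le _ _) _.
  rewrite -[X in (_ <= X)%O](submK le_fg).
  by rewrite lemc_add2l; apply: le_trans (mleadZ_le _ _) _; rewrite mleadXm.
have := ming _ (ideal_sub idJ Jg Jt) sgt.
rewrite le_eqVlt => /orP[/eqP E|].
  have := mlead_supp gt0; rewrite -E mcoeff_msupp mcoeffB Et subrr.
  by rewrite eqxx.
rewrite ltNge => /negP; apply.
by apply: le_trans (mleadB_le _ _) _; rewrite leUx lexx lt.
Qed.

(** * Graded ideals *)

Section NatMin.
Implicit Types A : set nat.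

Lemma nat_minP A d : A d ->
  A (nat_min A) /\ forall e, A e -> (nat_min A <= e)%N.
Proof.
move=> Ad; rewrite /nat_min; case: xgetP => [m _ []//|none].
have exA : exists d, `[< A d >] by exists d; apply/asboolP.
have [m /asboolP Am minm] := ex_minnP exA.
by exfalso; apply: (none m); split=> // e Ae; apply: minm; apply/asboolP.
Qed.

Lemma nat_min_mem A d : A d -> A (nat_min A).
Proof. by case/nat_minP. Qed.

Lemma nat_min_le A d : A d -> (nat_min A <= d)%N.
Proof. by move=> Ad; have [_] := nat_minP Ad; apply. Qed.

Lemma nat_maxP A d b : A d -> (forall e, A e -> (e <= b)%N) ->
  A (nat_max A) /\ forall e, A e -> (e <= nat_max A)%N.
Proof.
move=> Ad Ab; rewrite /nat_max; case: xgetP => [m _ []//|none].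
have exA : exists d, `[< A d >] by exists d; apply/asboolP.
have Ab' e : `[< A e >] -> (e <= b)%N by move=> /asboolP/Ab.
have [m /asboolP Am maxm] := ex_maxnP exA Ab'.
by exfalso; apply: (none m); split=> // e Ae; apply: maxm; apply/asboolP.
Qed.

End NatMin.

Section Graded.
Variables (K : fieldType) (n : nat).
Local Notation S := {mpoly K[n]}.
Implicit Types (I J P : set S) (f g h u : S).

Local Notation pih := (pihomog mdeg).

Lemma pihomog_split f k : (msize f <= k)%N -> f = \sum_(d < k) pih d f.
Proof. exact: pihomog_partitionE. Qed.

Lemma pihomog_homog d e f : f \is e.-homog ->
  pih d f = if d == e then f else 0.
Proof.
move=> fe; case: eqP => [->|/eqP de]; first exact: pihomog_dE.
by apply: pihomog_ne0 fe; rewrite eq_sym.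
Qed.

Lemma pihomog_mul d e g f : g \is e.-homog ->
  pih d (g * f) = if (e <= d)%N then g * pih (d - e) f else 0.
Proof.
move=> ge; rewrite (pihomog_split (leqnn (msize f))) mulr_sumr raddf_sum /=.
have prodE i : pih d (g * pih i f) = if d == (e + i)%N then g * pih i f else 0.
  by apply: pihomog_homog; apply: dhomogM => //; apply: pihomogP.
under eq_bigr do rewrite prodE.
case: leqP => [le_ed|lt_de]; last first.
  rewrite big1 // => i _; case: eqP => // E.
  by move: lt_de; rewrite E ltnNge leq_addr.
rewrite raddf_sum mulr_sumr; apply: eq_bigr => i _ /=.
rewrite (pihomog_homog _ (pihomogP _ _ _)) -[d in LHS](subnKC le_ed) eqn_add2l.
by case: eqP => //; rewrite mulr0.
Qed.

Section IdealComponents.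
Variables (J : set S) (idJ : is_ideal J).

Lemma mem_pihomog_homog d e f : f \is e.-homog -> J f -> J (pih d f).
Proof.
move=> fe Jf; rewrite (pihomog_homog _ fe).
by case: eqP => // _; apply: ideal_zero.
Qed.

Lemma mem_of_pihomog f : (forall d, J (pih d f)) -> J f.
Proof.
move=> Jf; rewrite (pihomog_split (leqnn (msize f))).
by apply: ideal_sum.
Qed.

Lemma mem_pihomog_mul g f : (forall d, J (pih d f)) ->
  forall d, J (pih d (g * f)).
Proof.
move=> Jf d; rewrite (pihomog_split (leqnn (msize g))) mulr_suml raddf_sum /=.
apply: ideal_sum => // i _ _; rewrite (pihomog_mul _ _ (pihomogP _ _ _)).
by case: leqP => _; [apply: ideal_mull|apply: ideal_zero].
Qed.

Lemma homog_components_ideal : is_ideal [set f | forall d, J (pih d f)].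
Proof.
split=> [d|a u v Ju Jv d]; first by rewrite raddf0; apply: ideal_zero.
by rewrite raddfD /=; apply: ideal_add => //; apply: mem_pihomog_mul.
Qed.

End IdealComponents.

Lemma graded_ideal_gen (A : set S) :
  (forall f d, A f -> ideal_gen A (pih d f)) -> graded (ideal_gen A).
Proof.
move=> homA f d Af; have idA := ideal_gen_ideal A.
apply: (ideal_gen_min (homog_components_ideal idA) _ Af).
by move=> g Ag e; apply: homA.
Qed.

(** By induction on the number of degrees in which the witness [f] has a
    component outside [J].  If [u] lies in [P] and has no component of degree
    below [s], then [u_s f_r] lies in [J] for the lowest degree [r] of [f];
    so either [u_s] lies in [P] or [u_s * f] is a witness with fewer
    components. *)
Lemma graded_prime_colon J f : is_ideal J -> graded J ->
  is_prime_ideal (colon J [set f]) -> graded (colon J [set f]).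
Proof.
move=> idJ grJ.
suff claim N r : forall f,
    (forall d, (d < r)%N || (r + N <= d)%N -> J (pih d f)) ->
    is_prime_ideal (colon J [set f]) -> graded (colon J [set f]).
  apply: (claim (msize f) 0%N) => d /=; rewrite add0n => fd.
  have dN m : m \in msupp f -> mdeg m != d.
    by move=> /msize_mdeg_lt mf; rewrite neq_ltn (leq_trans mf).
  rewrite pihomogE big_seq_cond big1 => [|m /andP[/dN/negPf->]//].
  exact: ideal_zero.
elim: N r => [|N IHN] r {}f Jf prP.
  have [_ P1 _] := (is_prime_idealE _).1 prP.
  case: P1; apply/colon1E; rewrite mul1r; apply: mem_of_pihomog => // d.
  by apply: Jf; rewrite addn0; case: ltnP.
set P := colon J [set f] in prP *.
have [idP P1 prPM] := (is_prime_idealE _).1 prP.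
have lowest u s : P u -> (forall i, (i < s)%N -> pih i u = 0) -> P (pih s u).
  move=> Pu u_low; apply: contrapT => Pus.
  have Jusf_r : J (pih s u * pih r f).
    have := grJ _ (s + r)%N ((colon1E _ _ _).1 Pu).
    rewrite [X in X * f](pihomog_split (leq_maxl (msize u) s.+1)).
    rewrite mulr_suml raddf_sum /=.
    set k := maxn _ _; have sk : (s < k)%N by rewrite leq_max ltnSn orbT.
    rewrite (bigD1 (Ordinal sk)) //= (pihomog_mul _ _ (pihomogP _ _ _)).
    rewrite leq_addr addKn => Jsum.
    rewrite -[_ * _](addrK (\sum_(i < k | i != Ordinal sk)
      pih (s + r) (pih i u * f))).
    apply: ideal_sub => //; apply: ideal_sum => // i _ neq_is.
    rewrite (pihomog_mul _ _ (pihomogP _ _ _)).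
    case: leqP => le_i; last exact: ideal_zero.
    case: (ltngtP i s) => [/u_low->|lt_si|E]; last first.
      by case/eqP: neq_is; apply: val_inj.
      apply: ideal_mull => //; apply: Jf; apply/orP; left.
      lia.
    by rewrite mul0r; apply: ideal_zero.
  have colonE : colon J [set pih s u * f] = P.
    apply/seteqP; split=> v /colon1E Jv.
      have /prPM[//|//] : P (v * pih s u) by apply/colon1E; rewrite -mulrA.
    by apply/colon1E; rewrite mulrCA; apply: ideal_mull.
  have grP : graded P.
    rewrite -colonE; apply: (IHN (s + r).+1); last by rewrite colonE.
    move=> d; rewrite (pihomog_mul _ _ (pihomogP _ _ _)).
    case: (leqP s d) => [le_sd|_ _]; last exact: ideal_zero.
    case: (eqVneq (d - s)%N r) => [->//|neq rng].
    by apply: ideal_mull => //; apply: Jf; lia.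
  exact/Pus/grP.
move=> u d Pu; elim/ltn_ind: d => d IHd.
pose u' := u - \sum_(i < d) pih i u.
have Pu' : P u'.
  apply: (ideal_sub idP) => //; apply: (ideal_sum idP) => i _ _.
  exact/IHd/ltn_ord.
have pihu' i : pih i (\sum_(j < d) pih j u) = if (i < d)%N then pih i u else 0.
  rewrite raddf_sum /=.
  rewrite (eq_bigr (fun j : 'I_d => if i == j then pih i u else 0)); last first.
    move=> j _; rewrite (pihomog_homog _ (pihomogP _ _ _)).
    by case: eqP => // ->.
  rewrite -big_mkcond; case: ltnP => [lt_id|le_di].
    by rewrite (big_pred1 (Ordinal lt_id)) // => j; rewrite eq_sym.
  rewrite big_pred0 // => j; apply/eqP => E.
  by have := ltn_ord j; rewrite -E ltnNge le_di.
suff : P (pih d u') by rewrite raddfB /= pihu' ltnn subr0.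
apply: lowest => // i lt_id; by rewrite raddfB /= pihu' lt_id subrr.
Qed.

(** Once [P = J : f] is graded it is contained in each [J : f_d], and the
    product of elements of [(J : f_d) \ P] would lie in [P]. *)
Lemma homogeneous_witness J f : is_ideal J -> graded J ->
  is_prime_ideal (colon J [set f]) ->
  exists d g, g \is d.-homog /\ colon J [set g] = colon J [set f].
Proof.
move=> idJ grJ prP; have grP := graded_prime_colon idJ grJ prP.
set P := colon J [set f] in prP grP *.
have [idP P1 prPM] := (is_prime_idealE _).1 prP.
have subP d : P `<=` colon J [set pih d f].
  move=> u Pu; apply: mem_of_pihomog => [|e]; first exact: colon1_ideal.
  have /colon1E/(grJ _ (e + d)%N) := grP _ e Pu.
  rewrite (pihomog_mul _ _ (pihomogP _ _ _)) leq_addr addKn.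
  by move/colon1E.
apply: contrapT => nod; apply: P1.
have wit d : exists a, ~ P a /\ J (a * pih d f).
  apply: contrapT => noa; apply: nod; exists d, (pih d f).
  split; first exact: pihomogP.
  apply/seteqP; split; last exact: subP.
  by move=> a /colon1E Ja; apply: contrapT => Pa; apply: noa; exists a.
have [a aP] := choice wit.
have prodP N : P (\prod_(d < N) a d) -> P 1.
  elim: N => [|N IHN]; rewrite ?big_ord0 // big_ord_recr /= => /prPM[/IHN//|].
  by have [] := aP N.
apply: (prodP (msize f)); apply/colon1E.
rewrite [X in _ * X](pihomog_split (leqnn (msize f))) mulr_sumr.
apply: ideal_sum => // d _ _; rewrite (bigD1 d) //= mulrAC.
by apply: (ideal_mulr idJ); have [] := aP d.
Qed.

Section Frobenius.
Variable q : nat.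
Hypothesis q_pchar : [pchar K].-nat q.

Lemma pchar_exp_gt0 : (0 < q)%N. Proof. by case/andP: q_pchar. Qed.

Lemma exprD_frob f g : (f + g) ^+ q = f ^+ q + g ^+ q.
Proof.
apply: exprDn_pchar; apply: sub_in_pnat q_pchar => p _.
exact: (rmorph_pchar (mpolyC n (R := K))).
Qed.

Lemma expr_sum_frob (T : Type) (s : seq T) (Q : pred T) (F : T -> S) :
  (\sum_(t <- s | Q t) F t) ^+ q = \sum_(t <- s | Q t) F t ^+ q.
Proof.
apply: (big_morph _ exprD_frob).
by rewrite expr0n; case: q pchar_exp_gt0.
Qed.

End Frobenius.

End Graded.

(** * Cartier maps *)

(** The maps [phi] with [phi (a ^+ q * x) = a * phi x] stand in for the flatness
    of Frobenius: they send [J^[q]] into [J], and together they detect it. *)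
Definition cartier (R : comNzRingType) (q : nat) (phi : R -> R) : Prop :=
  (forall x y, phi (x + y) = phi x + phi y) /\
  (forall a x, phi (a ^+ q * x) = a * phi x).

Section CartierTheory.
Variables (R : comNzRingType) (q : nat) (phi : R -> R).
Hypothesis phiC : cartier q phi.

Lemma cartierD x y : phi (x + y) = phi x + phi y.
Proof. by case: phiC. Qed.

Lemma cartierM a x : phi (a ^+ q * x) = a * phi x.
Proof. by case: phiC. Qed.

Lemma cartier0 : phi 0 = 0.
Proof. by apply: (addrI (phi 0)); rewrite -cartierD !addr0. Qed.

Lemma cartier_sum (T : Type) (s : seq T) (Q : pred T) (F : T -> R) :
  phi (\sum_(t <- s | Q t) F t) = \sum_(t <- s | Q t) phi (F t).
Proof. exact: (big_morph _ cartierD cartier0). Qed.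

Lemma cartier_frob_power J f : is_ideal J -> frob_power q J f -> J (phi f).
Proof.
move=> idJ [s [sJ ->]]; rewrite cartier_sum; apply: ideal_sum => // t ts _.
by have [b Jb <-] := sJ t ts; rewrite mulrC cartierM; apply: ideal_mulr.
Qed.

End CartierTheory.

Section CartierField.
Variables (K : fieldType) (q : nat).
Hypothesis q_pchar : [pchar K].-nat q.

Let exprD_q (x y : K) : (x + y) ^+ q = x ^+ q + y ^+ q.
Proof. exact: exprDn_pchar. Qed.

Let q_gt0 : (0 < q)%N. Proof. exact: (pchar_exp_gt0 q_pchar). Qed.

Let expr0_q : 0 ^+ q = 0 :> K.
Proof. by rewrite expr0n eqn0Ngt q_gt0. Qed.

Let exprN_q (x : K) : (- x) ^+ q = - x ^+ q.
Proof. by apply: (addrI (x ^+ q)); rewrite -exprD_q !subrr expr0_q. Qed.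

(** A splitting of Frobenius on [K]: project along a [K^q]-hyperplane [W]
    maximal among the [K^q]-subspaces that avoid [1]. *)
Lemma exists_frobenius_splitting :
  exists lam : K -> K, cartier q lam /\ lam 1 = 1.
Proof.
pose Q (W : set K) := [/\ ~ W 1, forall x y, W x -> W y -> W (x + y) &
  forall a x, W x -> W (a ^+ q * x)].
have [W [[W1 WD WM] maxW]] : exists W, Q W /\ forall B, W `<` B -> ~ Q B.
  apply: Zorn_bigcup => F FQ totF; split.
  - by move=> [X FX X1]; have [] := FQ X FX.
  - move=> x y [X FX Xx] [Y FY Yy].
    have [XY|YX] := totF _ _ FX FY.
      by exists Y => //; have [_ + _] := FQ Y FY; apply=> //; apply: XY.
    by exists X => //; have [_ + _] := FQ X FX; apply=> //; apply: YX.
  - by move=> a x [X FX Xx]; exists X => //; have [_ _] := FQ X FX; apply.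
have W0 : W 0.
  apply: contrapT => W0; apply: (maxW [set 0]).
    split=> [x Wx|/(_ 0 erefl)//]; case: W0.
    by have := WM 0 x Wx; rewrite expr0_q mul0r.
  split=> [/eqP|x y /= -> ->|a x /= ->]; rewrite ?addr0 ?mulr0 //.
  by rewrite oner_eq0.
have WN x : W x -> W (- x).
  by move=> /(WM (-1)); rewrite exprN_q expr1n mulN1r.
have proj x : exists a, W (x - a ^+ q).
  have [Wx|nWx] := pselect (W x).
    by exists 0; rewrite expr0_q subr0.
  pose B : set K := [set y | exists w b, W w /\ y = w + b ^+ q * x].
  have WB : W `<` B.
    split=> [w Ww|sub].
      by exists w, 0; rewrite expr0_q mul0r addr0.
    apply/nWx/sub; exists 0, 1; split=> //.
    by rewrite expr1n mul1r add0r.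
  have [w [b [Ww E]]] : B 1.
    apply: contrapT => B1; apply: (maxW B WB); split=> //.
      move=> _ _ [w [b [Ww ->]]] [w' [b' [Ww' ->]]]; exists (w + w'), (b + b').
      by split; [exact: WD|rewrite exprD_q mulrDl addrACA].
    move=> a _ [w [b [Ww ->]]]; exists (a ^+ q * w), (a * b).
    by split; [exact: WM|rewrite exprMn mulrDr mulrA].
  have b0 : b != 0.
    by apply/eqP => b0; apply: W1; rewrite E b0 expr0_q mul0r addr0.
  exists b^-1; rewrite [X in W X](_ : _ = b^-1 ^+ q * (- w)); first exact/WM/WN.
  have bq0 : b ^+ q != 0 by rewrite expf_neq0.
  apply: (mulfI bq0); rewrite mulrA mulrBr -exprMn divff // expr1n mul1r.
  by rewrite {1}E opprD addrCA subrr addr0.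
have uniq_proj x a b : W (x - a ^+ q) -> W (x - b ^+ q) -> a = b.
  move=> Wa Wb; apply: contrapT => /eqP; rewrite -subr_eq0 => ab0; apply: W1.
  have : W ((a - b) ^+ q).
    have := WD _ _ Wb (WN _ Wa); rewrite exprD_q exprN_q.
    by rewrite (_ : _ + _ = a ^+ q - b ^+ q) //; ring.
  by move=> /(WM (a - b)^-1); rewrite -exprMn mulVf // expr1n.
have [lam lamP] := choice proj.
exists lam; split; last by apply: uniq_proj (lamP 1) _; rewrite expr1n subrr.
split=> [x y|a x]; apply: uniq_proj (lamP _) _.
  by rewrite exprD_q opprD addrACA; apply: WD.
by rewrite exprMn -mulrBr; apply: WM.
Qed.

(** The [lam i] are the [q]-th roots of the coordinate functions of a partial
    basis of [K] over its subfield of [q]-th powers.  By induction on [cs]: a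
    scalar [c] not reproduced by [x |-> \sum_i lam i x ^+ q * e i] adds its
    error [c - \sum_i lam i c ^+ q * e i] to the basis. *)
Lemma cartier_coordinates (cs : seq K) :
  exists N (lam : nat -> K -> K) (e : nat -> K),
    (forall i, cartier q (lam i)) /\
    (forall c, c \in cs -> c = \sum_(i < N) lam i c ^+ q * e i).
Proof.
have [lam0 [lam0C lam01]] := exists_frobenius_splitting.
elim: cs => [|c cs [N [lam [e [lamC csE]]]]].
  by exists 0%N, (fun=> lam0), (fun=> 0).
pose pr x := \sum_(i < N) lam i x ^+ q * e i.
have prD x y : pr (x + y) = pr x + pr y.
  rewrite -big_split; apply: eq_bigr => i _ /=.
  by rewrite (cartierD (lamC i)) exprD_q mulrDl.
have prM a x : pr (a ^+ q * x) = a ^+ q * pr x.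
  rewrite mulr_sumr; apply: eq_bigr => i _.
  by rewrite (cartierM (lamC i)) exprMn mulrA.
have [c0|c0] := eqVneq (c - pr c) 0.
  exists N, lam, e; split=> // x; rewrite inE => /orP[/eqP->|/csE//].
  by apply/eqP; rewrite -subr_eq0 c0.
pose mu x := lam0 ((x - pr x) / (c - pr c)).
have muC : cartier q mu.
  split=> [x y|a x]; rewrite /mu.
    by rewrite prD opprD addrACA mulrDl (cartierD lam0C).
  by rewrite prM -mulrBr -mulrA (cartierM lam0C).
exists N.+1, (fun i => if (i < N)%N then lam i else mu),
  (fun i => if (i < N)%N then e i else c - pr c); split.
  by move=> i; case: ifP.
move=> x; rewrite inE big_ord_recr /= ltnn => xcs.
have -> : \sum_(i < N) (if (i < N)%N then lam i else mu) x ^+ q *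
    (if (i < N)%N then e i else c - pr c) = pr x.
  by apply: eq_bigr => i _; rewrite ltn_ord.
case/orP: xcs => [/eqP->|/csE E].
  by rewrite /mu divff // lam01 expr1n mul1r addrC subrK.
have E' : pr x = x by rewrite [RHS]E.
by rewrite /mu E' subrr mul0r (cartier0 lam0C) expr0_q mul0r addr0.
Qed.

End CartierField.

Section CartierMpoly.
Variables (K : fieldType) (n : nat) (q : nat).
Hypothesis q_pchar : [pchar K].-nat q.
Local Notation S := {mpoly K[n]}.
Implicit Types (f g h : S) (a k m : 'X_{1..n}) (J : set S).

Let q_gt0 : (0 < q)%N. Proof. exact: (pchar_exp_gt0 q_pchar). Qed.

Definition mnm_div k : 'X_{1..n} := [multinom k i %/ q | i < n]%N.
Definition mnm_mod k : 'X_{1..n} := [multinom k i %% q | i < n]%N.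

Lemma mnm_divE k : (mnm_div k *+ q + mnm_mod k)%MM = k.
Proof. by apply/mnmP => i; rewrite mnmDE mulmnE !mnmE -divn_eq. Qed.

Lemma mnm_mod_lt k i : (mnm_mod k i < q)%N.
Proof. by rewrite mnmE ltn_mod. Qed.

Lemma mnm_div_modE m a : (forall i, a i < q)%N -> forall k,
  (k == (m *+ q + a)%MM) = (mnm_div k == m) && (mnm_mod k == a).
Proof.
move=> aq k; apply/eqP/andP=> [->|[/eqP<- /eqP<-]]; last by rewrite mnm_divE.
split; apply/eqP/mnmP => i; rewrite mnmE mnmDE mulmnE.
  by rewrite divnMDl // divn_small ?addn0.
by rewrite modnMDl modn_small.
Qed.

Lemma mcoeffXM k f m :
  ('X_[k] * f)@_m = if (k <= m)%MM then f@_(m - k) else 0.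
Proof.
rewrite mulrC; case: ifP => [km|nkm].
  by rewrite -[X in mcoeff X _](submK km) addmC mcoeffMX.
apply: memN_msupp_eq0; rewrite (perm_mem (msuppMX _ _)).
by apply/negP => /mapP[m' _ E]; rewrite E lem_addr in nkm.
Qed.

(** The Cartier map selecting the monomials with exponents congruent to [a]
    modulo [q], with [lam] acting on their coefficients. *)
Definition cartier_mpoly (lam : K -> K) a f : S :=
  \sum_(k <- msupp f | mnm_mod k == a) lam (f@_k) *: 'X_[mnm_div k].

Section Lambda.
Variables (lam : K -> K) (lamC : cartier q lam).

Lemma cartier_mpolyX a k : cartier_mpoly lam a 'X_[k] =
  if mnm_mod k == a then lam 1 *: 'X_[mnm_div k] else 0.
Proof. by rewrite /cartier_mpoly msuppX big_mkcond big_seq1 mcoeffX eqxx. Qed.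

Variables (a : 'X_{1..n}) (a_lt : forall i, (a i < q)%N).

Lemma mcoeff_cartier_mpoly f m :
  (cartier_mpoly lam a f)@_m = lam f@_(m *+ q + a).
Proof.
rewrite raddf_sum /=.
rewrite (eq_bigr (fun k => if mnm_div k == m then lam f@_k else 0)); last first.
  by move=> k _; rewrite mcoeffZ mcoeffX; case: eqP; rewrite ?mulr1 ?mulr0.
rewrite -big_mkcondr -big_filter.
rewrite (eq_filter (a2 := pred1 (m *+ q + a)%MM)); last first.
  by move=> k; rewrite /= mnm_div_modE // andbC.
have [fm|nfm] := boolP ((m *+ q + a)%MM \in msupp f).
  by rewrite filter_pred1_uniq ?msupp_uniq // big_seq1.
rewrite (memN_msupp_eq0 nfm) (cartier0 lamC) big_seq big1 // => k.
by rewrite mem_filter => /andP[/eqP-> fk]; rewrite fk in nfm.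
Qed.

Lemma cartier_mpoly_cartier : cartier q (cartier_mpoly lam a).
Proof.
have addM f g : cartier_mpoly lam a (f + g) =
    cartier_mpoly lam a f + cartier_mpoly lam a g.
  apply/mpolyP => m; rewrite mcoeffD !mcoeff_cartier_mpoly mcoeffD.
  exact: (cartierD lamC).
split=> // g h.
have sumM (T : Type) (s : seq T) (F : T -> S) :
    cartier_mpoly lam a (\sum_(t <- s) F t) =
    \sum_(t <- s) cartier_mpoly lam a (F t).
  by apply: (big_morph _ addM); rewrite /cartier_mpoly msupp0 big_nil.
rewrite {1}[g]mpolyE (expr_sum_frob q_pchar) mulr_suml sumM.
rewrite [g in RHS]mpolyE mulr_suml; apply: eq_bigr => k _.
apply/mpolyP => m; rewrite mcoeff_cartier_mpoly exprZn mpolyXn.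
rewrite -!scalerAl !mcoeffZ (cartierM lamC) !mcoeffXM mcoeff_cartier_mpoly.
have -> : (k *+ q <= m *+ q + a)%MM = (k <= m)%MM.
  apply/mnm_lepP/mnm_lepP => km i; have := km i; rewrite mnmDE !mulmnE.
    move=> le_km; rewrite -ltnS -(ltn_pmul2r q_gt0) mulSn addnC.
    by apply: leq_ltn_trans le_km _; rewrite ltn_add2l.
  by move=> le_km; rewrite (leq_trans _ (leq_addr _ _)) // leq_mul2r le_km orbT.
case: ifP => [/mnm_lepP km|_]; last by rewrite (cartier0 lamC).
congr (_ * lam _@_ _); apply/mnmP => i.
by rewrite !(mnmDE, mnmBE, mulmnE) mulnBl addnBAC // leq_mul2r km orbT.
Qed.

Lemma cartier_mpoly_homog d f : f \is d.-homog ->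
  cartier_mpoly lam a f \is ((d - mdeg a) %/ q).-homog.
Proof.
move=> /dhomogP fd; apply/dhomogP => m.
rewrite mcoeff_msupp mcoeff_cartier_mpoly.
move=> lam0; have /fd /= <- : (m *+ q + a)%MM \in msupp f.
  rewrite mcoeff_msupp; apply: contraNneq lam0 => ->.
  by rewrite (cartier0 lamC).
by rewrite mdegD mdegMn addnK mulnK.
Qed.

End Lambda.

Lemma frob_power_of_cartier J f :
  (forall lam a, cartier q lam -> (forall i, a i < q)%N ->
     J (cartier_mpoly lam a f)) -> frob_power q J f.
Proof.
move=> Jf; have idJ := ideal_gen_ideal [set a ^+ q | a in J].
have [N [lam [e [lamC coefE]]]] :=
  cartier_coordinates q_pchar [seq f@_k | k <- msupp f].
pose A := undup [seq mnm_mod k | k <- msupp f].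
have -> : f = \sum_(i < N) \sum_(a <- A)
    ((e i)%:MP * 'X_[a]) * cartier_mpoly (lam i) a f ^+ q.
  rewrite exchange_big [LHS]mpolyE /=.
  pose T i a k := ((e i)%:MP * 'X_[a]) * (lam i f@_k *: 'X_[mnm_div k]) ^+ q.
  rewrite [RHS](eq_bigr (fun a => \sum_(k <- msupp f | mnm_mod k == a)
      \sum_(i < N) T i a k)); last first.
    move=> a _; rewrite [RHS]exchange_big /=; apply: eq_bigr => i _ /=.
    by rewrite (expr_sum_frob q_pchar) mulr_sumr.
  rewrite (exchange_big_dep predT) //=; apply: eq_big_seq => k fk.
  rewrite -big_filter (_ : [seq _ <- _ | _] = [:: mnm_mod k]); last first.
    rewrite (eq_filter (a2 := pred1 (mnm_mod k))); last first.
      by move=> x; rewrite /= eq_sym.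
    by rewrite filter_pred1_uniq ?undup_uniq // mem_undup map_f.
  rewrite big_seq1 [f@_k]coefE; last exact: (map_f (fun k => f@_k)).
  rewrite -mul_mpolyC raddf_sum mulr_suml; apply: eq_bigr => i _ /=.
  rewrite /T exprZn mpolyXn !mul_mpolyC -scalerAr -scalerAl -mpolyXD addmC.
  by rewrite mnm_divE scalerA.
apply: ideal_sum => // i _ _.
apply: ideal_sum => // a /[!mem_undup]/mapP[k _ ->] _.
apply: ideal_mull => //; apply: mem_ideal_gen; eexists; last by [].
by apply: Jf => // j; apply: mnm_mod_lt.
Qed.

Lemma exists_cartier_nmem J f : is_ideal J -> ~ frob_power q J f ->
  exists phi : S -> S, [/\ cartier q phi, ~ J (phi f) &
    forall d g, g \is d.-homog ->
      exists2 d', (d' * q <= d)%N & phi g \is d'.-homog].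
Proof.
move=> idJ Jf; apply: contrapT => nophi; apply: Jf.
apply: frob_power_of_cartier => lam a lamC a_lt; apply: contrapT => Jf.
apply: nophi; exists (cartier_mpoly lam a); split=> // [|d g gd].
  exact: cartier_mpoly_cartier.
exists ((d - mdeg a) %/ q)%N; last exact: cartier_mpoly_homog.
exact: leq_trans (leq_divM _ _) (leq_subr _ _).
Qed.

Lemma mpolyX_frob_power J k : is_ideal J ->
  frob_power q J 'X_[k] <-> J 'X_[mnm_div k].
Proof.
move=> idJ; split=> [Jk|Jk].
  have [lam [lamC lam1]] := exists_frobenius_splitting q_pchar.
  have := cartier_frob_power (cartier_mpoly_cartier lamC (mnm_mod_lt k)) idJ Jk.
  by rewrite cartier_mpolyX eqxx lam1 scale1r.
rewrite -{1}(mnm_divE k) mpolyXD -mpolyXn; apply: ideal_mulr.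
  exact: ideal_gen_ideal.
by apply: mem_ideal_gen; exists 'X_[mnm_div k].
Qed.

End CartierMpoly.

(** * Dimension of polynomial rings *)

Section Dimension.
Variables (K : fieldType) (n : nat).
Local Notation S := {mpoly K[n]}.
Implicit Types (I J P : set S) (f g h : S).

Definition independent_mod (B : finType) (z : B -> S) P : Prop :=
  forall a : B -> K, P (\sum_b a b *: z b) -> forall b, a b = 0.

Lemma powers_independent P P' y N (w : nat -> S) :
  is_prime_ideal P -> is_ideal P' -> P `<=` P' -> ~ P y -> P' y ->
  (forall j, P' (w j) -> w j = 0) ->
  P (\sum_(j < N) y ^+ j * w j) -> forall j, (j < N)%N -> w j = 0.
Proof.
move=> /is_prime_idealE[idP _ prP] idP' PP' Py P'y.
elim: N w => // N IHN w w0; rewrite big_ord_recl expr0 mul1r.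
have -> : \sum_(i < N) y ^+ lift ord0 i * w (lift ord0 i) =
    y * \sum_(i < N) y ^+ i * w i.+1.
  by rewrite mulr_sumr; apply: eq_bigr => i _; rewrite exprS mulrA.
move=> Pw; have w00 : w 0%N = 0.
  apply: w0; rewrite -[w 0%N](addrK (y * \sum_(i < N) y ^+ i * w i.+1)).
  by apply: (ideal_sub idP'); [exact: PP'|exact: ideal_mulr].
move: Pw; rewrite w00 add0r => /prP[//|Pw] [|j] // jN.
by apply: (IHN (fun j => w j.+1)) jN => // i; apply: w0.
Qed.

Lemma msize_mul d e f g : (msize f <= d.+1)%N -> (msize g <= e.+1)%N ->
  (msize (f * g) <= (d + e).+1)%N.
Proof.
move=> fd ge; have [->|f0] := eqVneq f 0; first by rewrite mul0r msize0.
have [->|g0] := eqVneq g 0; first by rewrite mulr0 msize0.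
rewrite msizeM //; move: (msize f) (msize g) fd ge => a b; lia.
Qed.

Lemma msize_exp d f i : (msize f <= d.+1)%N -> (msize (f ^+ i) <= (i * d).+1)%N.
Proof.
move=> fd; elim: i => [|i IHi]; first by rewrite expr0 msize1.
by rewrite exprS mulSn; apply: msize_mul.
Qed.

(** If [y_i] lies in [c_(i+1)] but not in [c_i], the monomials in
    [y_0, ..., y_(k-1)] are linearly independent modulo [c_0]: factoring out
    the least power of [y_0] in a relation, and then working modulo [c_1],
    leaves a relation between the others. *)
Lemma chain_independent_family (c : nat -> set S) k (y : nat -> S) D N :
  prime_chain c k -> (forall i, (i < k)%N -> c i.+1 (y i) /\ ~ c i (y i)) ->
  (forall i, (i < k)%N -> (msize (y i) <= D.+1)%N) ->
  exists (B : finType) (z : B -> S), [/\ #|B| = (N ^ k)%N,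
    forall b, (msize (z b) <= (k * (N * D)).+1)%N & independent_mod z (c 0%N)].
Proof.
elim: k c y => [|k IHk] c y [prc ltc] yc yD.
  exists unit, (fun=> 1); split=> [|b|a]; first by rewrite card_unit.
    by rewrite msize1.
  have /is_prime_idealE[idc c1 _] := prc _ (leqnn 0%N).
  rewrite (big_pred1 tt) => [ca []|[]//].
  apply: contrapT => /eqP a0; apply: c1.
  rewrite (_ : 1 = (a tt)^-1%:MP * (a tt *: 1)); first exact: ideal_mull.
  by rewrite mul_mpolyC scalerA mulVf // scale1r.
have [|||B [z [cardB zD zfree]]] := IHk (fun i => c i.+1) (fun i => y i.+1).
- by split=> i ik; [apply: prc|apply: ltc].
- by move=> i ik; apply: yc.
- by move=> i ik; apply: yD.
pose z' (ib : 'I_N * B) := y 0%N ^+ ib.1 * z ib.2.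
exists ('I_N * B)%type, z'; split=> [|[i b]|a].
- by rewrite card_prod card_ord cardB expnS.
- rewrite /z' mulSn; apply: msize_mul => //=.
  apply: leq_trans (msize_exp _ (yD 0%N _)) _ => //.
  by rewrite ltnS leq_mul2r ltnW ?orbT.
pose a' j b := oapp (fun i : 'I_N => a (i, b)) 0 (insub j).
have a'E (i : 'I_N) b : a' i b = a (i, b) by rewrite /a' valK.
pose w j := \sum_b a' j b *: z b.
have -> : \sum_ib a ib *: z' ib = \sum_(j < N) y 0%N ^+ j * w j.
  rewrite (eq_bigr (fun ib => a (ib.1, ib.2) *: z' (ib.1, ib.2))); last by case.
  rewrite -(pair_bigA _ (fun i b => a (i, b) *: z' (i, b))) /=.
  apply: eq_bigr => i _; rewrite mulr_sumr; apply: eq_bigr => b _.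
  by rewrite a'E -scalerAr.
have [idc1 _ _] := (is_prime_idealE _).1 (prc 1%N isT).
have [c1y0 c0y0] := yc 0%N isT.
have [sub _] := ltc 0%N isT.
move=> cw [i b]; have w0 : w i = 0.
  apply: (powers_independent (prc 0%N isT) idc1 _ c0y0 c1y0 _ cw) => // j wj.
  by rewrite /w big1 // => b' _; rewrite (zfree _ wj) scale0r.
rewrite -a'E; apply: (zfree (a' i)); rewrite -/(w i) w0.
exact: ideal_zero.
Qed.

Lemma card_bmultinom d : (#|{: 'X_{1..n < d}}| <= d ^ n)%N.
Proof.
have lt_d (m : 'X_{1..n < d}) i : (m i < d)%N.
  by apply: leq_ltn_trans (bmdeg m); rewrite mdegE (bigD1 i) //= leq_addr.
pose F (m : 'X_{1..n < d}) := [ffun i => Ordinal (lt_d m i)].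
have /leq_card : injective F.
  move=> m1 m2 /ffunP E; apply/val_inj/mnmP => i.
  by have := E i; rewrite !ffunE => /(congr1 val).
by rewrite card_ffun !card_ord.
Qed.

Lemma independent_card (B : finType) (z : B -> S) P d : P 0 ->
  independent_mod z P -> (forall b, (msize (z b) <= d)%N) -> (#|B| <= d ^ n)%N.
Proof.
move=> P0 zfree zd; apply: leq_trans (card_bmultinom d); rewrite leqNgt.
apply/negP => ltMB; pose M := 'X_{1..n < d} : finType.
pose A := \matrix_(i < #|B|, j < #|M|)
  (z (enum_val i))@_(enum_val j : 'X_{1..n < d}).
have /rowV0Pn[v /sub_kermxP vA v0] : kermx A != 0.
  rewrite -mxrank_eq0 mxrank_ker subn_eq0 -ltnNge.
  exact: leq_ltn_trans (rank_leq_col _) _.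
case/eqP: v0; apply/rowP => i; rewrite mxE -[i]enum_valK.
apply: (zfree (fun b => v ord0 (enum_rank b))).
suff -> : \sum_b v ord0 (enum_rank b) *: z b = 0 by [].
apply/mpolyP => m; rewrite mcoeff0 raddf_sum /=.
have [md|dm] := ltnP (mdeg m) d; last first.
  rewrite big1 // => b _; rewrite mcoeffZ [_@_m]memN_msupp_eq0 ?mulr0 //.
  by apply: msize_mdeg_ge; apply: leq_trans dm.
have := congr1 (fun A : 'rV_ _ => A ord0 (enum_rank (BMultinom md : M))) vA.
rewrite !mxE (reindex (@enum_rank B)) /=; last first.
  by apply: onW_bij; apply: enum_rank_bij.
move=> E; rewrite -[RHS]E; apply: eq_bigr => b _.
by rewrite mxE mcoeffZ !enum_rankK.
Qed.

(** With a chain of [n + 1] strict inclusions, [N ^ n.+1] monomials in the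
    [y_i] would be independent in a space of dimension [O(N ^ n)]. *)
Lemma prime_chain_length (c : nat -> set S) k : prime_chain c k -> (k <= n)%N.
Proof.
move=> [prc ltc]; rewrite leqNgt; apply/negP => ltnk.
have wit i : exists y, (i < k)%N -> c i.+1 y /\ ~ c i y.
  have [ik|ki] := ltnP i k; last by exists 0.
  have [sub /existsNP[y /not_implyP[cSy cy]]] := ltc i ik.
  by exists y.
have [y yP] := choice wit.
pose D := (\max_(i < n.+1) msize (y i))%N.
(* The monomials have degree less than N * d, so that N ^ n.+1 <= (N * d) ^ n;
   any N greater than d ^ n contradicts this. *)
pose d := (n.+1 * D).+1.
have [|||B [z [cardB zD zfree]]] :=
    @chain_independent_family c n.+1 y D (d ^ n).+1.
- by split=> i ik; [apply: prc|apply: ltc]; lia.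
- by move=> i ik; apply: yP; lia.
- by move=> i ik; apply: leqW; rewrite (leq_bigmax (Ordinal ik)).
have [idc0 _ _] := (is_prime_idealE _).1 (prc 0%N (leq0n _)).
have := independent_card (ideal_zero idc0) zfree zD.
rewrite cardB; set N := (d ^ n).+1 => le_card.
have : (N ^ n.+1 <= (N * d) ^ n)%N.
  apply: leq_trans le_card _.
  have le_d : ((n.+1 * (N * D)).+1 <= N * d)%N.
    by rewrite /d mulnS mulnCA -add1n leq_add2r.
  by case: (posnP n) => [->//|n0]; rewrite leq_exp2r.
rewrite expnMn expnS mulnC leq_pmul2l ?expn_gt0 //.
by rewrite /N ltnn.
Qed.

(** The prime ideal generated by the variables [x_i] with [i] in [A], as the
    kernel of the substitution killing these variables. *)
Definition var_prime (A : {pred 'I_n}) : set S :=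
  [set f | f \mPo [tuple if i \in A then 0 else 'X_i | i < n] = 0].

Lemma var_prime_prime A : is_prime_ideal (var_prime A).
Proof.
apply/is_prime_idealE; split=> [|/eqP|u v /eqP].
- split; first exact: comp_mpoly0.
  move=> a u v; rewrite /var_prime /= comp_mpolyD rmorphM /= => -> ->.
  by rewrite mulr0 addr0.
- by rewrite comp_mpoly1 oner_eq0.
- by rewrite rmorphM mulf_eq0 => /orP[]/eqP; [left|right].
Qed.

Lemma var_primeX A m : var_prime A 'X_[m] <-> exists2 i, i \in A & m i != 0%N.
Proof.
rewrite /var_prime /= comp_mpolyX; split=> [/eqP|[i iA mi]].
  rewrite prodf_seq_eq0 => /hasP[i _]; rewrite tnth_mktuple /= expf_eq0.
  rewrite lt0n => /andP[mi]; case: ifP => [iA _|_]; first by exists i.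
  by rewrite -msupp_eq0 msuppX.
by rewrite (bigD1 i) //= tnth_mktuple iA expr0n (negPf mi) mul0r.
Qed.

Lemma var_prime_msupp A f :
  var_prime A f <-> forall m, m \in msupp f -> var_prime A 'X_[m].
Proof.
have idA : is_ideal (var_prime A).
  by have /is_prime_idealE[] := var_prime_prime A.
split=> [|Pf]; last first.
  rewrite [f]mpolyE; apply: ideal_sum => // m fm _.
  by rewrite -mul_mpolyC; apply: ideal_mull => //; apply: Pf.
pose killed (m : 'X_{1..n}) := [exists i in A, m i != 0%N].
have killedP m : reflect (var_prime A 'X_[m]) (killed m).
  apply: (iffP idP) => [/existsP[i /andP[iA mi]]|/var_primeX[i iA mi]].
    by apply/var_primeX; exists i.
  by apply/existsP; exists i; rewrite iA.
move=> Pf m fm; apply/killedP; apply: contraT => nkm.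
have keep (m' : 'X_{1..n}) : ~~ killed m' ->
    'X_[m'] \mPo [tuple if i \in A then 0 else 'X_i | i < n] = 'X_[K, m'].
  move=> nk; rewrite comp_mpolyX [RHS]mpolyXE_id; apply: eq_bigr => i _.
  rewrite tnth_mktuple; case: ifP => // iA.
  have /eqP-> : m' i == 0%N.
    by apply: contraR nk => mi; apply/existsP; exists i; rewrite iA.
  by rewrite !expr0.
have : (f \mPo [tuple if i \in A then 0 else 'X_i | i < n])@_m = f@_m.
  rewrite {1}[f]mpolyE [_ \mPo _]raddf_sum raddf_sum /=.
  rewrite (bigD1_seq m) ?msupp_uniq //= comp_mpolyZ keep //.
  rewrite mcoeffZ mcoeffX eqxx mulr1.
  rewrite big1 ?addr0 // => m' neq; rewrite comp_mpolyZ mcoeffZ.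
  have [km'|nkm'] := boolP (killed m').
    by have /killedP -> := km'; rewrite mcoeff0 mulr0.
  by rewrite keep // mcoeffX (negPf neq) mulr0.
by rewrite Pf mcoeff0 => /esym/eqP; rewrite mcoeff_eq0 fm.
Qed.

Lemma var_prime_ltS (l : seq 'I_n) i : uniq l -> (i < size l)%N ->
  var_prime [pred x in take i l] `<` var_prime [pred x in take i.+1 l].
Proof.
move=> ul il; have x0 : 'I_n by case: l il {ul}.
rewrite (take_nth x0 il); split=> [f|sub].
  move=> /var_prime_msupp Pf; apply/var_prime_msupp => m.
  move=> /Pf/var_primeX[j jl mj]; apply/var_primeX; exists j => //.
  by rewrite inE mem_rcons inE [j \in _]jl orbT.
have : var_prime [pred x in take i l] 'X_(nth x0 l i).
  apply: sub; apply/var_primeX; exists (nth x0 l i).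
    by rewrite inE mem_rcons mem_head.
  by rewrite mnm1E eqxx.
move=> /var_primeX[j jl]; rewrite mnm1E eqb0 negbK => /eqP E.
by move: jl; rewrite inE -E in_take_leq ?index_uniq ?ltnn // ltnW.
Qed.

Lemma eq_var_prime A B : A =i B -> var_prime A = var_prime B.
Proof.
move=> AB; rewrite /var_prime.
suff -> : [tuple if i \in A then 0 else 'X_i : S | i < n] =
    [tuple if i \in B then 0 else 'X_i | i < n] by [].
by apply/eq_from_tnth => i; rewrite !tnth_mktuple AB.
Qed.

Lemma var_prime_chain (A : {pred 'I_n}) : exists c : nat -> set S,
  prime_chain c n /\ c #|A| = var_prime A.
Proof.
pose l := enum A ++ enum [predC A].
have size_l : size l = n.
  by rewrite size_cat -!cardE cardC card_ord.
exists (fun i => var_prime [pred x in take i l]); split.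
  split=> i ik; first exact: var_prime_prime.
  apply: var_prime_ltS; last by rewrite size_l.
  rewrite cat_uniq !enum_uniq andbT; apply/hasPn => x.
  by rewrite !mem_enum.
apply: eq_var_prime => i; rewrite inE take_size_cat ?mem_enum //.
exact/esym/cardE.
Qed.

Lemma krull_dim_mpoly : krull_dim {mpoly K[n]} = n.
Proof.
have [c [chain_c _]] := var_prime_chain pred0.
have ub k : (exists c : nat -> set S, prime_chain c k) -> (k <= n)%N.
  by move=> [c' /prime_chain_length].
have [[c' /prime_chain_length le] max] :=
  @nat_maxP _ n n (ex_intro _ c chain_c) ub.
by apply/eqP; rewrite eqn_leq le max //; exists c.
Qed.

Lemma prime_heightP P : is_prime_ideal P ->
  (exists c, prime_chain c (prime_height P) /\ c (prime_height P) = P) /\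
  (forall c k, prime_chain c k -> c k = P -> (k <= prime_height P)%N).
Proof.
move=> prP; have [|k [c [/prime_chain_length le_kn _]]|wit max] :=
    @nat_maxP [set k | exists c, prime_chain c k /\ c k = P] 0%N n.
- by exists (fun=> P); split=> //; split.
- by [].
by split=> // c k chain_c ckP; apply: max; exists c.
Qed.

Lemma prime_height_le P : is_prime_ideal P -> (prime_height P <= n)%N.
Proof. by case/prime_heightP=> [[c [/prime_chain_length]]]. Qed.

(** The lower bound is a chain of variable ideals below [var_prime A]; for the
    upper bound, any chain ending at [var_prime A] is prolonged by the
    [n - #|A|] variable ideals above it. *)
Lemma prime_height_var (A : {pred 'I_n}) : prime_height (var_prime A) = #|A|.
Proof.
have [Q [[prQ ltQ] QA]] := var_prime_chain A.
have le_An : (#|A| <= n)%N by rewrite -[X in (_ <= X)%N]card_ord max_card.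
have [[c [[prc ltc] ckA]] max] := prime_heightP (var_prime_prime A).
move: le_An QA; set a := #|A| => le_An QA.
apply/eqP; rewrite eqn_leq; apply/andP; split; last first.
  apply: (max Q) => //; split=> i iA; first exact/prQ/(leq_trans iA).
  exact/ltQ/(leq_trans iA).
set k := prime_height _ in c prc ltc ckA max *.
pose c' i := if (i <= k)%N then c i else Q (i - k + a)%N.
suff /prime_chain_length : prime_chain c' (k + (n - a)) by lia.
split=> i ik; rewrite /c'.
  by case: leqP => ki; [apply: prc|apply: prQ; lia].
case: (ltngtP i k) ik => [lt_ik _|lt_ki ik|-> ik]; first exact: ltc.
  by rewrite subSn ?[(k <= i)%N]ltnW // addSn; apply: ltQ; lia.
by rewrite ckA subSnn -QA; apply: ltQ; lia.
Qed.

End Dimension.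

(** * Frobenius powers, the initial degree [alpha] and v-numbers *)

Section FrobeniusPowers.
Variables (K : fieldType) (n : nat).
Local Notation S := {mpoly K[n]}.
Implicit Types (I J P : set S) (f g h u : S).

Lemma frob_power_ideal q I : is_ideal (frob_power q I).
Proof. exact: ideal_gen_ideal. Qed.

Lemma mem_frob_power q I f : I f -> frob_power q I (f ^+ q).
Proof. by move=> If; apply: mem_ideal_gen; exists f. Qed.

Lemma frob_power_sub q I : (0 < q)%N -> is_ideal I -> frob_power q I `<=` I.
Proof.
by move=> q0 idI; apply: ideal_gen_min => // _ [a Ia <-]; apply: ideal_exp.
Qed.

Lemma frob_power_mul q r I : [pchar K].-nat r ->
  frob_power (q * r) I = frob_power r (frob_power q I).
Proof.
move=> hr; apply/seteqP; split.
  apply: ideal_gen_min; first exact: frob_power_ideal.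
  by move=> _ [a Ia <-]; rewrite exprM; apply/mem_frob_power/mem_frob_power.
apply: ideal_gen_min; first exact: frob_power_ideal.
move=> _ [_ [s [sI ->]] <-]; rewrite (expr_sum_frob hr).
apply: ideal_sum => [|t ts _]; first exact: frob_power_ideal.
have [a Ia <-] := sI t ts; rewrite exprMn -exprM.
by apply: ideal_mull; [exact: frob_power_ideal|exact: mem_frob_power].
Qed.

Lemma frob_power_graded q I : [pchar K].-nat q -> graded I ->
  graded (frob_power q I).
Proof.
move=> hq grI; apply: graded_ideal_gen => _ d [a Ia <-].
rewrite (pihomog_split (leqnn (msize a))) (expr_sum_frob hq) raddf_sum /=.
apply: ideal_sum => [|i _ _]; first exact: frob_power_ideal.
apply: (@mem_pihomog_homog _ _ _ (frob_power_ideal q I) d (i * q)%N).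
  by apply: dhomogMn; apply: pihomogP.
exact/mem_frob_power/grI.
Qed.

Lemma prime_exp P f k : is_prime_ideal P -> P (f ^+ k) -> P f.
Proof.
move=> /is_prime_idealE[_ P1 prP]; elim: k => [|k IHk]; first by rewrite expr0.
by rewrite exprS => /prP[].
Qed.

Section VNumber.
Variables (J : set S) (idJ : is_ideal J) (grJ : graded J).

Lemma v_local_witness P : Ass J P ->
  exists2 g, g \is (v_local P J).-homog & colon J [set g] = P.
Proof.
move=> [prP [f fP]]; rewrite -fP in prP.
have [d [g [gd gP]]] := homogeneous_witness idJ grJ prP.
pose W := [set d | exists f, f \is d.-homog /\ colon J [set f] = P].
have : W d by exists g; rewrite gP.
by case/nat_min_mem => h []; exists h.
Qed.

Lemma v_number_le d g : g \is d.-homog -> is_prime_ideal (colon J [set g]) ->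
  (v_number J <= d)%N.
Proof.
move=> gd prP; apply: (@leq_trans (v_local (colon J [set g]) J)).
  by apply: nat_min_le; exists (colon J [set g]) => //; split=> //; exists g.
by apply: nat_min_le; exists g.
Qed.

Lemma v_number_witness : ~ J 1 ->
  exists2 g, g \is (v_number J).-homog & is_prime_ideal (colon J [set g]).
Proof.
move=> J1; have [u prP] := exists_prime_colon (@mpoly_noetherian K n) idJ J1.
have : [set v_local P J | P in Ass J] (v_local (colon J [set 1 * u]) J).
  by exists (colon J [set 1 * u]) => //; split=> //; exists (1 * u).
move/nat_min_mem => [P AssP E]; have [g gd gP] := v_local_witness AssP.
by exists g; [rewrite /v_number -E|rewrite gP; case: AssP].
Qed.

End VNumber.

Section Alpha.
Variables (I : set S) (hI : is_proper_ideal I) (grI : graded I).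

Let idI : is_ideal I. Proof. by case/is_proper_idealE: hI. Qed.

Lemma frob_power_proper q : (0 < q)%N -> ~ frob_power q I 1.
Proof. by move=> q0 /(frob_power_sub q0 idI); case/is_proper_idealE: hI. Qed.

Lemma alpha_le q d f : f \is d.-homog -> colon (frob_power q I) I f ->
  ~ frob_power q I f -> (alpha q I <= d)%N.
Proof. by move=> fd cf nf; apply: nat_min_le; exists f. Qed.

Lemma homogeneous_generators : exists2 s : seq S,
  I = ideal_gen [set` s] & forall t, t \in s -> exists d, t \is d.-homog.
Proof.
have [s Es] := mpoly_noetherian idI.
pose s' := [seq pihomog mdeg d f | f <- s, d <- iota 0 (msize f)].
exists s' => [|_ /allpairsPdep[f [d [_ _ ->]]]]; last first.
  by exists d; apply: pihomogP.
apply/seteqP; split.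
  rewrite {1}Es; apply: ideal_gen_min; first exact: ideal_gen_ideal.
  move=> f /= fs; rewrite (pihomog_split (leqnn (msize f))).
  apply: ideal_sum => [|d _ _]; first exact: ideal_gen_ideal.
  apply: mem_ideal_gen; apply/allpairsPdep; exists f, (val d).
  by rewrite mem_iota add0n ltn_ord.
apply: ideal_gen_min => // _ /allpairsPdep[f [d [fs _ ->]]].
by apply: grI; rewrite Es; apply: mem_ideal_gen.
Qed.

(** Multiply [f] by each [t] in [s] as often as possible without entering
    [J]; since [t ^+ q] is in [J] this happens fewer than [q] times. *)
Lemma greedy_multiple J q D (s : seq S) d f : is_ideal J ->
  (forall t, t \in s -> J (t ^+ q) /\ exists2 e, (e <= D)%N & t \is e.-homog) ->
  f \is d.-homog -> ~ J f ->
  exists d' g, [/\ g \is d'.-homog, (d' <= d + size s * (D * q))%N, ~ J g,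
    forall t, t \in s -> J (g * t) & forall h, J (f * h) -> J (g * h)].
Proof.
move=> idJ; elim: s d f => [|t s IHs] d f sJ fd Jf.
  by exists d, f; split=> //; rewrite addn0.
have [Jtq [e eD te]] := sJ t (mem_head _ _).
pose Q b := `[< J (f * t ^+ b) >].
have exQ : exists b, Q b.
  by exists q; apply/asboolP; apply: ideal_mull.
have [[|b] /asboolP Jb minb] := ex_minnP exQ.
  by case: Jf; rewrite expr0 mulr1 in Jb.
have le_bq : (b <= q)%N.
  apply: ltnW; apply: minb; apply/asboolP; exact: ideal_mull.
have [||d' [g [gd' le_d' Jg gs gh]]] := IHs (d + e * b)%N (f * t ^+ b) _
    (dhomogM fd (dhomogMn _ te)).
- by move=> t' t's; apply: sJ; rewrite inE t's orbT.
- by move=> /asboolP/minb; rewrite ltnn.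
exists d', g; split=> // [|t'|h Jfh].
- apply: leq_trans le_d' _; rewrite -addnA leq_add2l mulSn leq_add2r.
  exact: leq_mul.
- rewrite inE => /orP[/eqP->|/gs//]; apply: gh.
  by rewrite -mulrA -exprSr.
- by apply: gh; rewrite mulrAC; apply: ideal_mulr.
Qed.

Lemma alpha_witness_bounded : exists C, forall q, (0 < q)%N ->
  exists d f, [/\ f \is d.-homog, colon (frob_power q I) I f,
    ~ frob_power q I f & (d <= C * q)%N].
Proof.
have [s Is sd] := homogeneous_generators.
have [D sD] : exists D, forall t, t \in s ->
    exists2 e, (e <= D)%N & t \is e.-homog.
  elim: s sd {Is} => [|t s IHs] sd; first by exists 0%N.
  have [|D sD] := IHs; first by move=> t' t's; apply: sd; rewrite inE t's orbT.
  have [e te] := sd t (mem_head _ _).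
  exists (maxn e D) => t'; rewrite inE => /orP[/eqP->|/sD[e' le_e' t'e']].
    by exists e => //; apply: leq_maxl.
  by exists e' => //; rewrite leq_max le_e' orbT.
have Is_mem t : t \in s -> I t by move=> ts; rewrite Is; apply: mem_ideal_gen.
exists (size s * D)%N => q q0; have idq := frob_power_ideal q I.
have [t ts||d [g [gd le_d nJg gs _]]] :=
    @greedy_multiple _ q D s 0%N 1 idq _ _ (frob_power_proper q0).
- by split; [apply/mem_frob_power/Is_mem|apply: sD].
- exact: dhomog1.
exists d, g; split=> //; last by rewrite -mulnA.
have idc : is_ideal [set u | frob_power q I (g * u)].
  split=> /= [|a u v Ju Jv]; first by rewrite mulr0; apply: ideal_zero.
  by rewrite mulrDr mulrCA; apply: ideal_add => //; apply: ideal_mull.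
by move=> u; rewrite {1}Is; apply: (ideal_gen_min idc) => t /gs.
Qed.

Lemma alpha_witness q : (0 < q)%N -> exists f, [/\ f \is (alpha q I).-homog,
  colon (frob_power q I) I f & ~ frob_power q I f].
Proof.
move=> q0; have [C /(_ q q0)[d [f [fd cf nf _]]]] := alpha_witness_bounded.
pose W := [set d | exists f, [/\ f \is d.-homog,
  colon (frob_power q I) I f & ~ frob_power q I f]].
by have /nat_min_mem : W d by exists f.
Qed.

Lemma alpha_linear_bound : exists C, forall q, (0 < q)%N ->
  (alpha q I <= C * q)%N.
Proof.
have [C alphaC] := alpha_witness_bounded; exists C => q q0.
have [d [f [fd cf nf]]] := alphaC q q0.
by apply: leq_trans; apply: alpha_le fd cf nf.
Qed.

(** A homogeneous [f] with prime [I^[q] : f] is a candidate for [alpha]: the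
    prime contains [a ^+ q], hence [a], for all [a] in [I]. *)
Lemma alpha_le_v_number q : [pchar K].-nat q ->
  (alpha q I <= v_number (frob_power q I))%N.
Proof.
move=> hq; have q0 := pchar_exp_gt0 hq; have idq := frob_power_ideal q I.
have [g gd prP] := v_number_witness idq (frob_power_graded hq grI)
  (frob_power_proper q0).
apply: alpha_le gd _ _ => [u Iu|Jg].
  rewrite mulrC; apply/colon1E/(prime_exp (k := q) prP)/colon1E.
  by apply: ideal_mulr => //; apply: mem_frob_power.
have /is_prime_idealE[_ P1 _] := prP; apply: P1.
by apply/colon1E; rewrite mul1r.
Qed.

(** An optimal [f] for [q * r] lies outside [(I^[q])^[r]], so some [r]-Cartier
    map [phi] has [phi f] outside [I^[q]]; it divides degrees by [r], and
    [phi f * g = phi (g ^+ r * f)] lies in [I^[q]] for [g] in [I]. *)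
Lemma alpha_mul q r : (0 < q)%N -> [pchar K].-nat r ->
  (alpha q I * r <= alpha (q * r) I)%N.
Proof.
move=> q0 hr; have r0 := pchar_exp_gt0 hr.
have [|f [fd cf nf]] := @alpha_witness (q * r)%N; first by rewrite muln_gt0 q0.
rewrite (frob_power_mul _ _ hr) in cf nf.
have idq := frob_power_ideal q I.
have [phi [phiC nphi phi_homog]] := exists_cartier_nmem hr idq nf.
have [d le_d phid] := phi_homog _ _ fd.
apply: leq_trans le_d; rewrite leq_mul2r; apply/orP; right.
apply: alpha_le phid _ nphi => g Ig.
rewrite mulrC -(cartierM phiC); apply: (cartier_frob_power phiC) => //.
by rewrite mulrC; apply: cf; apply: ideal_exp.
Qed.

(** For an optimal [f] some [q]-Cartier map has [phi f] outside [I], and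
    [I^[q] : f] is contained in [I : phi f], hence in an associated prime
    [P = I : g] of [I].  As [g] avoids [P] and [f] multiplies [I] into
    [I^[q]], the product [f * g] satisfies [I^[q] : (f * g) = P]. *)
Lemma radical_v_number_le q : is_radical_ideal I -> [pchar K].-nat q ->
  exists2 P, Ass I P & (v_number (frob_power q I) <= alpha q I + v_local P I)%N.
Proof.
move=> radI hq; have q0 := pchar_exp_gt0 hq; have idq := frob_power_ideal q I.
have [f [fd cf nf]] := alpha_witness q0.
have [phi [phiC nphi _]] := exists_cartier_nmem hq idI nf.
have [u prP] := exists_prime_colon (@mpoly_noetherian K n) idI nphi.
set P := colon I [set phi f * u] in prP.
have AssP : Ass I P by split=> //; exists (phi f * u).
exists P => //; have [g gd gP] := v_local_witness idI grI AssP.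
have nPg : ~ P g.
  by rewrite -gP; apply: radical_colon_nmem => //; rewrite gP.
apply: v_number_le (dhomogM fd gd) _.
rewrite (_ : colon _ _ = P) //; apply/seteqP; split=> x.
  move/colon1E => Jxfg; have [_ _ prPM] := (is_prime_idealE _).1 prP.
  have : P (x * g).
    apply/colon1E; rewrite mulrA; apply: ideal_mulr => //.
    rewrite -(cartierM phiC); apply: (cartier_frob_power phiC) => //.
    have -> : (x * g) ^+ q = x * g * (x * g) ^+ q.-1 by rewrite -exprS prednK.
    rewrite mulrAC; apply: ideal_mulr => //.
    by rewrite -mulrA [g * f]mulrC.
  by case/prPM.
rewrite -[in P x]gP => /colon1E Ixg; apply/colon1E.
by rewrite mulrCA; apply: cf.
Qed.

Lemma radical_v_number_sub_alpha : is_radical_ideal I ->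
  exists2 P, Ass I P & forall q, [pchar K].-nat q ->
    (v_number (frob_power q I) <= alpha q I + v_local P I)%N.
Proof.
move=> radI; pose W w := exists2 P, Ass I P & v_local P I = w.
have [M vM] := radical_Ass_bounded (fun P => v_local P I)
  (@mpoly_noetherian K n) idI radI.
have [P0 AssP0 _] := radical_v_number_le radI (isT : [pchar K].-nat 1%N).
have [|w [P AssP <-]|[P AssP maxE] max] := @nat_maxP W (v_local P0 I) M.
- by exists P0.
- exact: vM.
exists P => // q hq; have [P' AssP' le_v] := radical_v_number_le radI hq.
apply: leq_trans le_v _; rewrite leq_add2l maxE; apply: max.
by exists P'.
Qed.

End Alpha.

End FrobeniusPowers.

(** * Monomial ideals *)

Section MonomialIdeals.
Variables (K : fieldType) (n : nat).
Local Notation S := {mpoly K[n]}.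
Implicit Types (I J P : set S) (f g h u : S) (m k : 'X_{1..n}).

Definition monomial_closed J : Prop :=
  forall f m, m \in msupp f -> J f -> J 'X_[m].

Lemma monomial_support_ideal J : is_ideal J ->
  is_ideal [set f : S | forall m, m \in msupp f -> J 'X_[m]].
Proof.
move=> idJ; split=> [m|a u v Ju Jv m]; first by rewrite msupp0.
move/msuppD_le; rewrite mem_cat => /orP[/msuppM_le/allpairsP[[m1 m2] /=]|/Jv//].
by case=> _ /Ju Jm2 ->; rewrite mpolyXD; apply: ideal_mull.
Qed.

Lemma mem_of_msupp J f : is_ideal J ->
  (forall m, m \in msupp f -> J 'X_[m]) -> J f.
Proof.
move=> idJ Jf; rewrite [f]mpolyE; apply: ideal_sum => // m fm _.
by rewrite -mul_mpolyC; apply: ideal_mull => //; apply: Jf.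
Qed.

Lemma monomial_ideal_closed I : is_monomial_ideal I -> monomial_closed I.
Proof.
move=> [M ->] f m fm If; set A := [set _ | _ in M] in If *.
have ids := monomial_support_ideal (ideal_gen_ideal A).
move: m fm; apply: (ideal_gen_min ids _ If).
move=> _ [k Mk <-] m; rewrite msuppX inE => /eqP->.
by apply: mem_ideal_gen; exists k.
Qed.

Lemma frob_power_monomial_closed q I : [pchar K].-nat q -> monomial_closed I ->
  monomial_closed (frob_power q I).
Proof.
move=> hq closedI f m fm If; have idq := frob_power_ideal q I.
have ids := monomial_support_ideal idq.
move: m fm; apply: (ideal_gen_min ids _ If) => _ [a Ia <-].
rewrite [a]mpolyE (expr_sum_frob hq); apply: (ideal_sum ids) => k ak _.
rewrite exprZn mpolyXn -mul_mpolyC; apply: (ideal_mull ids) => m.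
rewrite msuppX inE => /eqP->; rewrite -mpolyXn; apply: mem_frob_power.
exact: closedI Ia.
Qed.

Lemma exists_min_monomial_gen I m : I 'X_[m] ->
  exists2 k, (k <= m)%MM & min_monomial_gen I k.
Proof.
have [d] := ubnP (mdeg m); elim: d m => // d IHd m; rewrite ltnS => le_md Im.
have [minm|] := pselect (forall k, I 'X_[k] -> (k <= m)%MM -> k = m).
  by exists m; [exact: lepm_refl|split].
move/existsNP => [k /not_implyP[Ik /not_implyP[le_km neq]]].
have [|k' le_k'k mink'] := IHd k _ Ik; last first.
  by exists k' => //; apply: lepm_trans le_k'k le_km.
apply: leq_trans le_md; rewrite -(submK le_km) mdegD -[X in (X < _)%N]add0n.
rewrite ltn_add2r lt0n mdeg_eq0; apply/eqP => E; apply: neq.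
by rewrite -[RHS](submK le_km) E add0m.
Qed.

(** The leading monomial of [f] raised to the [k] lies in [I], and a
    square-free generator dividing a power of a monomial divides the
    monomial; subtracting the leading term preserves [f ^+ k] modulo [I]. *)
Lemma squarefree_radical I : is_ideal I -> squarefree_monomial_ideal I ->
  is_radical_ideal I.
Proof.
move=> idI [/monomial_ideal_closed closedI sqfI] f k.
elim/mleadrect: f => f IHf Ifk.
have [->|f0] := eqVneq f 0; first exact: ideal_zero.
have Ilead : I 'X_[mlead f].
  have Ilk : I 'X_[mlead f *+ k].
    apply: closedI Ifk; rewrite -mleadX // mlead_supp //.
    by rewrite expf_neq0.
  have [g le_g [Ig ming]] := exists_min_monomial_gen Ilk.
  have le_gf : (g <= mlead f)%MM.
    apply/mnm_lepP => i; have := mnm_lepP le_g i; rewrite mulmnE.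
    have := sqfI g (conj Ig ming) i.
    by case: (g i) => [|[|//]] // _; case: (mlead f i).
  by rewrite -(submK le_gf) mpolyXD; apply: ideal_mull.
have It : I (f@_(mlead f) *: 'X_[mlead f]).
  by rewrite -mul_mpolyC; apply: ideal_mull.
rewrite -[f](subrK (f@_(mlead f) *: 'X_[mlead f])); apply: ideal_add => //.
set f' := f - _.
have [->|f'0] := eqVneq f' 0; first exact: ideal_zero.
apply: IHf; first exact: ltm_mleadD.
rewrite -[f' ^+ k](subKr (f ^+ k)); apply: ideal_sub => //.
by rewrite subrXX; apply: ideal_mulr => //; rewrite subKr.
Qed.

Lemma sub_Ass I P : is_ideal I -> Ass I P -> I `<=` P.
Proof. by move=> idI [_ [g <-]] f If; apply/colon1E; apply: ideal_mulr. Qed.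

Lemma radical_exists_Ass_nmem I f : is_ideal I -> is_radical_ideal I -> ~ I f ->
  exists2 P, Ass I P & ~ P f.
Proof.
move=> idI radI nIf.
have [u prP] := exists_prime_colon (@mpoly_noetherian K n) idI nIf.
exists (colon I [set f * u]); first by split=> //; exists (f * u).
move/colon1E => Iffu; apply: (radical_colon_nmem idI radI prP).
by apply/colon1E; rewrite mulrAC; apply: ideal_mulr.
Qed.

Lemma var_primeXU (A : {set 'I_n}) i : @var_prime K n A 'X_i <-> i \in A.
Proof.
split=> [/var_primeX[j jA]|iA]; first by rewrite mnm1E eqb0 negbK => /eqP->.
by apply/var_primeX; exists i; rewrite ?mnm1E ?eqxx.
Qed.

(** Let [A] be the set of variables in [P = I : g].  Every monomial of an
    element of [I] lies in [P], so [I] is contained in [var_prime A]; as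
    [P * g] lies in [I] and [g] avoids [P], the prime [var_prime A] contains
    [P].  A monomial of [g] outside [P] is a monomial witness. *)
Lemma radical_monomial_Ass I P : is_ideal I -> is_radical_ideal I ->
  monomial_closed I -> Ass I P -> exists A : {set 'I_n}, P = var_prime A /\
  exists2 m, ~ var_prime A 'X_[K, m] & forall i, i \in A -> I ('X_i * 'X_[m]).
Proof.
move=> idI radI closedI AssP; have [prP [g gP]] := AssP.
have [idP P1 prPM] := (is_prime_idealE _).1 prP.
have nPg : ~ P g by rewrite -gP; apply: radical_colon_nmem => //; rewrite gP.
pose A := [set i : 'I_n | `[< P 'X_i >]]%SET.
have AE i : i \in A <-> P 'X_i by rewrite inE; split=> /asboolP.
have [idA _ prA] := (is_prime_idealE _).1 (var_prime_prime K A).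
have subAP : var_prime A `<=` P.
  move=> f /var_prime_msupp Af; apply: mem_of_msupp => // m.
  move=> /Af/var_primeX[i /AE Pi mi].
  have le_im : (U_(i) <= m)%MM by rewrite lep1mP.
  by rewrite -(submK le_im) mpolyXD; apply: ideal_mull.
have subIA : I `<=` var_prime A.
  move=> f If; apply/var_prime_msupp => m fm; apply/var_primeX.
  have : P 'X_[m] by apply: (sub_Ass idI AssP); apply: closedI If.
  rewrite mpolyXE_id.
  elim/big_ind: _ => [/P1//|x y IHx IHy /prPM[/IHx|/IHy]//|i _ Pim].
  exists i; first by apply/AE; apply: prime_exp Pim.
  by apply/eqP => mi; apply: P1; rewrite mi expr0 in Pim.
have PA : P = var_prime A.
  apply/seteqP; split=> // f; rewrite -gP => /colon1E /subIA/prA[//|Ag].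
  by case: nPg; apply: subAP.
exists A; split=> //; apply: contrapT => nom; apply: nPg.
apply: mem_of_msupp => // m gm.
apply: contrapT => nPm; apply: nom; exists m => [|i /AE]; first by rewrite -PA.
rewrite -gP => /colon1E Iig; rewrite -mpolyXD; apply: closedI Iig.
rewrite mulrC (perm_mem (msuppMX _ _)); apply/mapP; exists m => //.
Qed.

Lemma unmixed_height I P : unmixed I -> Ass I P -> prime_height P = ht I.
Proof.
move=> unmI AssP; have hP : [set prime_height P | P in Ass I] (prime_height P).
  by exists P.
apply/eqP; rewrite eqn_leq; apply/andP; split; last exact: nat_min_le.
rewrite unmI; have [|_] := nat_maxP (b := n) hP; last exact.
by move=> _ [Q [prQ _] <-]; apply: prime_height_le.
Qed.

Section UnmixedSquarefree.
Variables (I : set S) (hI : is_proper_ideal I) (grI : graded I).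
Hypotheses (unmI : unmixed I) (sqfI : squarefree_monomial_ideal I).
Variable q : nat.
Hypothesis hq : [pchar K].-nat q.

Let idI : is_ideal I. Proof. by case/is_proper_idealE: hI. Qed.
Let I1 : ~ I 1. Proof. by case/is_proper_idealE: hI. Qed.
Let radI : is_radical_ideal I. Proof. exact: squarefree_radical. Qed.
Let closedI : monomial_closed I.
Proof. by apply: monomial_ideal_closed; case: sqfI. Qed.
Let q0 : (0 < q)%N. Proof. exact: pchar_exp_gt0 hq. Qed.

Lemma unmixed_card (A : {set 'I_n}) : Ass I (var_prime A) -> #|A| = ht I.
Proof. by move/(unmixed_height unmI); rewrite prime_height_var. Qed.

(** If [I : g] is generated by the variables in [A], then
    [g ^+ q * \prod_(i in A) 'X_i ^+ q.-1] is in [I^[q] : I], and a Cartier map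
    sends it to [g], which is not in [I]. *)
Lemma alpha_le_v_number_ht : (alpha q I <= q * (v_number I + ht I))%N.
Proof.
have [g gd prP] := v_number_witness idI grI I1.
have AssP : Ass I (colon I [set g]) by split=> //; exists g.
have [A [PA _]] := radical_monomial_Ass idI radI closedI AssP.
rewrite PA in AssP; have cardA := unmixed_card AssP.
pose a := [multinom if i \in A then q.-1 else 0%N | i < n].
have dega : mdeg a = (ht I * q.-1)%N.
  rewrite mdegE (eq_bigr (fun i => if i \in A then q.-1 else 0%N)); last first.
    by move=> i _; rewrite mnmE.
  by rewrite -big_mkcond sum_nat_const cardA.
apply: (@leq_trans (v_number I * q + ht I * q.-1)%N); last first.
  by rewrite mulnDr [(q * _)%N]mulnC leq_add2l mulnC leq_mul2r leq_pred orbT.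
have idq := frob_power_ideal q I.
apply: (@alpha_le _ _ _ q _ (g ^+ q * 'X_[a])).
- by rewrite -dega; apply: dhomogM; [apply: dhomogMn|rewrite dhomogX].
- move=> u Iu; have := sub_Ass idI AssP Iu => /var_prime_msupp Au.
  have idc : is_ideal [set w : S | frob_power q I (g ^+ q * 'X_[a] * w)].
    split=> /= [|b w w' Jw Jw']; first by rewrite mulr0; apply: ideal_zero.
    by rewrite mulrDr mulrCA; apply: ideal_add => //; apply: ideal_mull.
  apply: (mem_of_msupp idc) => m /Au/var_primeX[i iA mi] /=.
  have -> : g ^+ q * 'X_[a] * 'X_[m] =
      (g * 'X_i) ^+ q * 'X_[(a + m) - U_(i) *+ q]%MM.
    rewrite exprMn -!mulrA; congr (_ * _).
    rewrite mpolyXn -!mpolyXD [in RHS]addmC submK //.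
    apply/mnm_lepP => j; rewrite mulmnE mnm1E mnmDE mnmE.
    case: eqP => [<-|_]; rewrite ?mul0n ?mul1n ?iA //.
    by rewrite -lt0n in mi; rewrite -{1}(prednK q0) -addn1 leq_add2l.
  apply: ideal_mulr => //; apply: mem_frob_power; rewrite mulrC; apply/colon1E.
  by rewrite PA; apply/var_primeX; exists i => //; rewrite mnm1E eqxx.
- have a_lt i : (a i < q)%N by rewrite mnmE; case: ifP => _; rewrite ?prednK.
  have [lam [lamC lam1]] := exists_frobenius_splitting hq.
  have phiC := cartier_mpoly_cartier hq lamC a_lt.
  move/(cartier_frob_power phiC idI).
  rewrite (cartierM phiC) cartier_mpolyX lam1.
  have [-> ->] : mnm_mod q a = a /\ mnm_div q a = 0%MM.
    split; apply/mnmP => i; rewrite [LHS]mnmE; first by rewrite modn_small.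
    by rewrite divn_small // mnm0E.
  rewrite eqxx scale1r mpolyX0 mulr1 => Ig.
  have /is_prime_idealE[_ P1 _] := prP; apply: P1.
  by apply/colon1E; rewrite mul1r.
Qed.

(** Some monomial [m] of an optimal [f] is again optimal.  Let [a] be its
    exponent vector divided by [q]; then ['X_[a]] is not in [I], and [m] has
    exponent [q - 1] at each variable of each associated prime avoiding
    ['X_[a]].  If [U] is the set of these variables and [A] one of these
    primes, multiplying ['X_[a]] by the variables in [U :\: A] gives a
    witness for [var_prime A]; comparing degrees, the error is at most
    [#|U| <= n]. *)
Lemma v_number_ht_lt_alpha : (n < q)%N ->
  (q * (v_number I + ht I) < alpha q I + q)%N.
Proof.
move=> lt_nq; have idq := frob_power_ideal q I.
have closedq := frob_power_monomial_closed hq closedI.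
have [f [fd cf nf]] := alpha_witness hI grI q0.
have [m fm nm] : exists2 m, m \in msupp f & ~ frob_power q I 'X_[m].
  apply: contrapT => nom; apply: nf; apply: mem_of_msupp => // m fm.
  by apply: contrapT => nm; apply: nom; exists m.
have <- : mdeg m = alpha q I by move/dhomogP: fd; apply.
have cm k : I 'X_[k] -> frob_power q I 'X_[k + m].
  move=> Ik; apply: closedq (cf _ Ik); rewrite (perm_mem (msuppMX _ _)).
  exact: map_f.
pose a := mnm_div q m.
have nIa : ~ I 'X_[a] by move/(mpolyX_frob_power hq m idI).
have aq i : (a i * q <= m i)%N by rewrite mnmE leq_divM.
pose good (A : {set 'I_n}) := Ass I (var_prime A) /\ ~ var_prime A 'X_[K, a].
have a0 A i : good A -> i \in A -> a i = 0%N.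
  move=> [_ nAa] iA; apply/eqP; apply: contra_notT nAa => ai.
  by apply/var_primeX; exists i.
pose U := [set i | `[< exists2 A, good A & i \in A >]]%SET.
have mU i : i \in U -> m i = q.-1 /\ a i = 0%N.
  rewrite inE => /asboolP[A gA iA]; split; last exact: a0 gA iA.
  have [AssA _] := gA.
  have [B [BA [g nBg Ig]]] := radical_monomial_Ass idI radI closedI AssA.
  rewrite -BA in nBg.
  have {}Ig : I ('X_i * 'X_[g]).
    by apply: Ig; apply/var_primeXU; rewrite -BA; apply/var_primeXU.
  (* The monomial U_(i) + g + m lies in I^[q], hence its q-th root lies in
     var_prime A; at the variables of A the exponents of g vanish and those of
     m are less than q, so only the exponent at i can reach q. *)
  have := cm (U_(i) + g)%MM; rewrite mpolyXD => /(_ Ig).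
  move/(mpolyX_frob_power hq _ idI)/(sub_Ass idI AssA)/var_primeX => [j jA].
  have gj : g j = 0%N.
    apply/eqP; apply: contra_notT nBg => gj.
    by apply/var_primeX; exists j.
  rewrite mnmE !mnmDE gj addn0 mnm1E => nz.
  have mj : (m j < q)%N.
    have := a0 _ _ gA jA; rewrite mnmE => aj.
    by rewrite ltnNge -(divn_gt0 _ q0) aj.
  have mjq : (q <= (i == j) + m j)%N.
    by rewrite leqNgt; apply: contra nz => lt; rewrite divn_small.
  by case: eqP mjq => [->|_]; lia.
have [P AssP nPa] := radical_exists_Ass_nmem idI radI nIa.
have [A [PA _]] := radical_monomial_Ass idI radI closedI AssP.
rewrite {}PA in AssP nPa; have gA : good A by [].
have subU B : good B -> B \subset U.
  move=> gB; apply/fintype.subsetP => i iB; rewrite inE.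
  by apply/asboolP; exists B.
pose c := [multinom (i \in U :\: A : nat) | i < n].
have c_deg : (mdeg c + ht I)%N = #|U|.
  rewrite -(unmixed_card AssP) -(cardsID A U) addnC.
  have /finset.setIidPr -> := subU _ gA; congr addn.
  rewrite mdegE -sum1_card [RHS]big_mkcond; apply: eq_bigr => i _.
  by rewrite mnmE; case: (i \in _).
have le_v : (v_number I <= mdeg a + mdeg c)%N.
  have [_ _ prA] := (is_prime_idealE _).1 (var_prime_prime K A).
  apply: (@v_number_le _ _ _ _ 'X_[a + c]); first by rewrite dhomogX /= mdegD.
  rewrite (_ : colon _ _ = var_prime A); first exact: var_prime_prime.
  apply/seteqP; split=> u.
    move/colon1E/(sub_Ass idI AssP)/prA => [//|/var_primeX[i iA]].
    by rewrite mnmDE (a0 _ _ gA iA) mnmE inE iA.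
  move/var_prime_msupp => Au; apply: (mem_of_msupp (colon1_ideal _ idI)) => k.
  move=> /Au/var_primeX[i iA ki]; apply/colon1E; rewrite -mpolyXD.
  apply: contrapT => nI.
  have [Q AssQ nQ] := radical_exists_Ass_nmem idI radI nI.
  have [B [QB _]] := radical_monomial_Ass idI radI closedI AssQ.
  rewrite {}QB in AssQ nQ.
  have nz j : j \in B -> (k + (a + c))%MM j = 0%N.
    move=> jB; apply/eqP; apply: contra_notT nQ => nz.
    by apply/var_primeX; exists j.
  have gB : good B.
    split=> // /var_primeX[j jB aj]; have := nz j jB.
    by rewrite !mnmDE => /eqP; rewrite !addn_eq0 (negPf aj) andbF.
  have subBA : B \subset A.
    apply/fintype.subsetP => j jB; have := nz j jB; rewrite !mnmDE => /eqP.
    rewrite !addn_eq0 => /and3P[_ _]; rewrite mnmE inE eqb0 negb_and negbK.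
    by rewrite (fintype.subsetP (subU _ gB)) // orbF.
  have EB : B = A.
    apply/eqP; rewrite eqEcard subBA.
    by rewrite (unmixed_card AssP) (unmixed_card AssQ) leqnn.
  have := nz i; rewrite EB mnmDE => /(_ iA)/eqP.
  by rewrite addn_eq0 (negPf ki).
have deg_m : (q * (mdeg a + #|U|) <= mdeg m + #|U|)%N.
  have -> : #|U| = (\sum_i (i \in U))%N.
    by rewrite -sum1_card big_mkcond; apply: eq_bigr => i _; case: (i \in U).
  rewrite !mdegE -!big_split big_distrr; apply: leq_sum => i _ /=.
  have [/mU[-> ->]|nU] := boolP (i \in U); last by rewrite !addn0 mulnC.
  by rewrite add0n muln1 addn1 prednK.
have le_Un : (#|U| <= n)%N by rewrite -[X in (_ <= X)%N]card_ord max_card.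
apply: leq_ltn_trans (_ : (_ <= q * (mdeg a + #|U|)))%N _.
  by rewrite leq_mul2l -c_deg addnA leq_add2r le_v orbT.
by apply: leq_ltn_trans deg_m _; rewrite ltn_add2l (leq_ltn_trans le_Un).
Qed.

End UnmixedSquarefree.

End MonomialIdeals.

(** * Comparison of [alpha] with the v-number *)

Theorem theorem4p8 (R : realType) (K : fieldType) (p n : nat)
    (hp : p \in [pchar K])
    (I : set {mpoly K[n]}) (hI : is_proper_ideal I) (hgr : graded I) :
  [/\ (* 1 *)
      (forall e : nat, (0 < e)%N ->
         (alpha (p ^ e) I <= v_number (frob_power (p ^ e) I))%N),
      (* 2 *)
      (forall e e' : nat, (0 < e)%N -> (e <= e')%N ->
         (alpha (p ^ e) I)%:R / (p ^ e)%:R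
           <= (alpha (p ^ e') I)%:R / (p ^ e')%:R :> R),
      (* 3 *)
      (exists l : R,
         (alpha (p ^ e) I)%:R / (p ^ e)%:R @[e --> \oo] --> l)
    & [/\ (* 4 *)
      (is_radical_ideal I ->
         exists P : set {mpoly K[n]}, Ass I P /\
           forall e : nat, (0 < e)%N ->
             ((v_number (frob_power (p ^ e) I))%:Z - (v_local P I)%:Z
                <= (alpha (p ^ e) I)%:Z)),
      (* 5 *)
      (is_radical_ideal I ->
         exists l : R,
           ((alpha (p ^ e) I)%:R / (p ^ e)%:R @[e --> \oo] --> l) /\
           ((v_number (frob_power (p ^ e) I))%:R / (p ^ e)%:R
              @[e --> \oo] --> l))
    & (* 6 *)
      (unmixed I -> squarefree_monomial_ideal I ->
         forall e : nat, (0 < e)%N -> (krull_dim {mpoly K[n]} < p ^ e)%N ->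
           Num.ceil ((alpha (p ^ e) I)%:R / (p ^ e)%:R : R)
             = (v_number I + ht I)%N%:Z)]].
Proof.
have p_prime : prime p by apply: pcharf_prime hp.
have hq e : [pchar K].-nat (p ^ e)%N.
  by rewrite pnatX pnatE // hp.
have q0 e : (0 < p ^ e)%N := pchar_exp_gt0 (hq e).
have qR0 e : 0 < (p ^ e)%:R :> R by rewrite ltr0n.
pose u e : R := (alpha (p ^ e) I)%:R / (p ^ e)%:R.
have u_mono : {homo u : e e' / (e <= e')%N >-> e <= e'}.
  move=> e e' le_ee'; rewrite /u ler_pdivrMr // mulrAC ler_pdivlMr //.
  rewrite -!natrM ler_nat -(subnKC le_ee') expnD.
  by rewrite [leqRHS]mulnC mulnCA leq_mul2l alpha_mul ?orbT.
have u_cvg : cvgn u.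
  apply: nondecreasing_is_cvgn => //.
  have [C alphaC] := alpha_linear_bound hI hgr.
  exists C%:R => _ [e _ <-]; rewrite ler_pdivrMr // -natrM ler_nat.
  exact: alphaC.
split; last split.
- by move=> e _; apply: alpha_le_v_number.
- by move=> e e' _; apply: u_mono.
- by exists (limn u).
- move=> radI; have [P AssP vP] := radical_v_number_sub_alpha hI hgr radI.
  exists P; split=> // e _; rewrite lerBlDr -PoszD lez_nat.
  exact: vP.
- move=> radI; have [P AssP vP] := radical_v_number_sub_alpha hI hgr radI.
  exists (limn u); split=> //.
  pose v e : R := (v_number (frob_power (p ^ e) I))%:R / (p ^ e)%:R.
  have inv_cvg : geometric (v_local P I)%:R p%:R^-1 @ \oo --> (0 : R).
    apply: cvg_geometric; rewrite ger0_norm ?invr_ge0 ?ler0n //.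
    by rewrite invf_lt1 ?ltr1n ?ltr0n ?prime_gt1 ?prime_gt0.
  have uD_cvg :
      (fun e => u e + geometric (v_local P I)%:R p%:R^-1 e) @ \oo --> limn u.
    by rewrite -[limn u]addr0; apply: cvgD.
  apply: (squeeze_cvgr _ u_cvg uD_cvg); apply: nearW => e; apply/andP; split.
    by rewrite ler_pM2r ?invr_gt0 // ler_nat; apply: alpha_le_v_number.
  rewrite /= exprVn -natrX /u -mulrDl ler_pM2r ?invr_gt0 // -natrD ler_nat.
  exact: vP.
- move=> unmI sqfI e _; rewrite krull_dim_mpoly => lt_nq.
  have le_up := alpha_le_v_number_ht hI hgr unmI sqfI (hq e).
  have lt_low := v_number_ht_lt_alpha hI hgr unmI sqfI (hq e) lt_nq.
  apply: ceil_def; apply/andP; split; last first.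
    by rewrite ler_pdivrMr // -pmulrn -natrM ler_nat mulnC.
  rewrite ltr_pdivlMr // intrD -pmulrn mulrBl mul1r ltrBlDr.
  by rewrite -natrM -natrD ltr_nat mulnC.
Qed.
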